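(* Let $\mathbb{F}$ be a finite field, let $w$ be an integer, let $\mathcal{F}$ be a minor-closed class of configurations over $\mathbb{F}$ with limiting density $\Delta$, and let $\{A_i : i \geq 1\}$ be a pruned sequence of configurations in $\mathcal{F}$ with branch-width at most $w$ such that $d(A_i) \rightarrow \Delta$ and $\epsilon(A_i) \rightarrow \infty$. Then there is an integer $q$ and an infinite sequence of non-trivial linked $q$-patches $\{H_j = (\widetilde{H_j}, S_j, T_j): j \geq 1\}$ such that, for each $j = 1, 2, \ldots$, (i) $\widetilde{H_j} \cap \langle S_j\rangle$ is empty, (ii) $\epsilon(\widetilde{H_j}) \geq \Delta(\dim\langle H_j\rangle - q)$, and (iii) there is a rooted configuration $F_j$ in $\mathcal{P}(H_1, \ldots, H_j)$ such that $\widetilde{F_j} \in \mathcal{F}$.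
   Context: A configuration over $\mathbb{F}$ is a finite multiset of vectors in an $\mathbb{F}$-vector space; $\langle A\rangle$ is linear span and $M(A)$ is the matroid on $A$ given by linear independence. $\epsilon(A)$ is the number of points (rank-one flats) of $M(A)$ and $d(A) = \epsilon(A)/\dim\langle A\rangle$; the branch-width of $A$ is that of $M(A)$. A configuration $A$ is a minor of $A'$ (written $A \overset{\mathcal{L}}{\leftarrow} A'$) if there is a linear map $\mathcal{L}$ from $\langle A'\rangle$ onto $\langle A\rangle$ whose kernel is spanned by a subset of $A'$ and with $A\subseteq \mathcal{L}(A')$; a class of configurations is minor-closed if it is closed under this relation. The limiting density of a set $\mathcal{F}$ of configurations is $\limsup_{n\to\infty}\max\{d(A) : A\in\mathcal{F}, \dim\langle A\rangle = n\}$. For a matroid $M$ with density $d(M)=\epsilon(M)/r(M)$, $M$ is $(\delta,k)$-pruned ($\delta>0$ real, $k$ positive integer) if every minor $N$ of $M$ with $r(N)\ge r(M)-k$ satisfies $\epsilon(M)-\epsilon(N) \geq (d(M)-\delta)(r(M)-r(N))$; a sequence of configurations $\{A_i\}$ is pruned if for every $\delta>0$ and positive integer $k$ there is $m$ such that $M(A_n)$ is $(\delta,k)$-pruned for all $n\ge m$. A rooted configuration is a triple $(A,L,R)$ of configurations, $L,R$ ordered sequences, such that there is a configuration $A^*$ partitioned into $A,L,R$ with $L,R$ each linearly independent, $R\subseteq\langle A\cup L\rangle$, $L\subseteq\langle A\cup R\rangle$; write $\widetilde H = A$, $\langle H\rangle = \langle A\cup L\cup R\rangle$. $H$ is non-trivial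 if $\dim\langle H\rangle > \dim\langle L\rangle = |L|$. A $q$-patch is a rooted configuration with $|L|=|R|=q$. Isomorphism of rooted configurations: a linear isomorphism of spans mapping $A_1$ onto $A_2$ and terminals onto terminals in order. $(A,L,R)$ is a minor of $(A',L',R')$ if there is a linear map $\mathcal{L}$ from $\langle (A',L',R')\rangle$ to $\langle (A,L,R)\rangle$ with $A\overset{\mathcal{L}}{\leftarrow}A'$ mapping the elements of $L',R'$ onto those of $L,R$ in order. A $q$-patch is linked if it has a minor $(A',L',R')$ with $L'=R'$ as ordered sequences. Product: if $(A,L,R)$ has $|L|,|R|\le q$, $(A_1,A_2)$ partitions $A$ with $\dim(\langle A_1\cup L\rangle\cap\langle A_2\cup R\rangle)\le q$, and $X$ is an ordered basis of this intersection, then $(A,L,R) = (A_1,L,X)\times(A_2,X,R)$; iterated products are defined by iteration. $\mathcal{P}(H_1,\ldots,H_k)$ is the set of all rooted configurations $H'_1\times\cdots\times H'_k$ with each $H'_i$ isomorphic to $H_i$. *)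

(* Defs.v *)
From mathcomp Require Import all_boot all_order all_algebra.
From mathcomp Require Import finmap multiset.
From mathcomp Require Import all_classical all_reals all_analysis.

Set Implicit Arguments.
Unset Strict Implicit.
Unset Printing Implicit Defensive.

Import Order.TTheory GRing.Theory Num.Theory.

Local Open Scope mset_scope.
Local Open Scope ring_scope.

(* Matroids on a subset [ground] of a finite type, given by their rank
   function.  By [rank_ground], elements outside the ground set act as loops
   under [rank]; they are never counted as elements of the matroid. *)
Record matroid (T : finType) := Matroid {
  ground : {set T};
  rank : {set T} -> nat;
  rank_ground : forall X, rank (X :&: ground) = rank X;
  rank_card : forall X : {set T}, (rank X <= #|X|)%N;
  rank_mono : forall X Y : {set T}, X \subset Y -> (rank X <= rank Y)%N;
  rank_submod : forall X Y : {set T},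
    (rank (X :|: Y) + rank (X :&: Y) <= rank X + rank Y)%N
}.

Section Matroid.
Context {T : finType}.
Implicit Types (M : matroid T) (X Y C D : {set T}).

Definition indep M X := (X \subset ground M) && (rank M X == #|X|).

Definition mrank M := rank M (ground M).

Definition flat M X :=
  (X \subset ground M) &&
  [forall x in ground M :\: X, (rank M X < rank M (x |: X))%N].

Definition num_points M := #|[set X | flat M X && (rank M X == 1%N)]|.

Lemma del_rank_ground M D X :
  rank M ((X :&: (ground M :\: D)) :\: D) = rank M (X :\: D).
Proof.
rewrite -[RHS]rank_ground; congr (rank M _).
by apply/finset.setP => x; rewrite !inE; case: (x \in D); rewrite ?andbF.
Qed.

Lemma del_rank_card M D X : (rank M (X :\: D) <= #|X|)%N.
Proof.
apply: leq_trans (rank_card _ _) _.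
exact/fintype.subset_leq_card/finset.subsetDl.
Qed.

Lemma del_rank_mono M D X Y :
  X \subset Y -> (rank M (X :\: D) <= rank M (Y :\: D))%N.
Proof. by move=> sXY; apply/rank_mono/finset.setSD. Qed.

Lemma del_rank_submod M D X Y :
  (rank M ((X :|: Y) :\: D) + rank M ((X :&: Y) :\: D)
     <= rank M (X :\: D) + rank M (Y :\: D))%N.
Proof. by rewrite finset.setDUl finset.setDIl rank_submod. Qed.

Definition delete M D : matroid T := {|
  ground := ground M :\: D;
  rank := fun X => rank M (X :\: D);
  rank_ground := del_rank_ground M D;
  rank_card := del_rank_card M D;
  rank_mono := @del_rank_mono M D;
  rank_submod := del_rank_submod M D |}.

Definition contract_rank M C X := (rank M (X :|: C) - rank M C)%N.

Lemma contract_rank_ground M C X :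
  contract_rank M C (X :&: (ground M :\: C)) = contract_rank M C X.
Proof.
congr (_ - _)%N; rewrite -rank_ground -[RHS]rank_ground; congr (rank M _).
apply/finset.setP => x; rewrite !inE.
by case: (x \in C); case: (x \in X); case: (x \in ground M).
Qed.

Lemma contract_rank_card M C X : (contract_rank M C X <= #|X|)%N.
Proof.
rewrite leq_subLR addnC; apply: leq_trans (leq_add (rank_card M X) (leqnn _)).
exact: leq_trans (leq_addr _ _) (rank_submod _ _ _).
Qed.

Lemma contract_rank_mono M C X Y :
  X \subset Y -> (contract_rank M C X <= contract_rank M C Y)%N.
Proof. by move=> sXY; apply/leq_sub2r/rank_mono/finset.setSU. Qed.

Lemma contract_rank_submod M C X Y :
  (contract_rank M C (X :|: Y) + contract_rank M C (X :&: Y)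
     <= contract_rank M C X + contract_rank M C Y)%N.
Proof.
have le Z : (rank M C <= rank M (Z :|: C))%N by apply/rank_mono/finset.subsetUr.
rewrite -(leq_add2r (rank M C + rank M C)) addnACA [X in (_ <= X)%N]addnACA.
rewrite /contract_rank !subnK //.
by rewrite finset.setUUl finset.setUIl rank_submod.
Qed.

Definition contract M C : matroid T := {|
  ground := ground M :\: C;
  rank := contract_rank M C;
  rank_ground := contract_rank_ground M C;
  rank_card := contract_rank_card M C;
  rank_mono := @contract_rank_mono M C;
  rank_submod := contract_rank_submod M C |}.

Definition matroid_minor M N := exists C D : {set T},
  [/\ C \subset ground M, D \subset ground M, [disjoint C & D]
    & N = delete (contract M C) D].

Definition mdensity (R : realType) M : R := (num_points M)%:R / (mrank M)%:R.

Definition pruned_matroid (R : realType) (delta : R) (k : nat) M :=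
  forall N, matroid_minor M N -> (mrank M <= mrank N + k)%N ->
    (num_points M)%:R - (num_points N)%:R
      >= (mdensity R M - delta) * ((mrank M)%:R - (mrank N)%:R).

Definition connectivity M X :=
  (rank M X + rank M (ground M :\: X) - mrank M + 1)%N.

(* [ucycle e p]: the distinct vertices [p] form a closed walk; a single edge
   is traversed back and forth by such a walk of size 2. *)
Definition is_tree (N : finType) (e : rel N) :=
  [/\ (0 < #|N|)%N, symmetric e, irreflexive e, forall x y, connect e x y
    & forall p, ucycle e p -> (size p <= 2)%N].

Definition degree (N : finType) (e : rel N) (v : N) := #|[set u | e v u]|.

(* Branch-decompositions use cubic trees: every vertex has degree 1 or 3. *)
Definition branch_decomposition M (N : finType) (e : rel N) (f : T -> N) :=
  [/\ is_tree e,
      forall v, degree e v = 1%N \/ degree e v = 3%N,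
      {in ground M, forall x, degree e (f x) = 1%N}
    & {in ground M &, injective f}].

Definition remove_edge (N : finType) (e : rel N) (u v : N) : rel N :=
  [rel x y | e x y && ((x, y) != (u, v)) && ((x, y) != (v, u))].

(* The elements labelling the component of u in the tree minus the edge uv. *)
Definition displayed M (N : finType) (e : rel N) (f : T -> N) (u v : N) :=
  [set x in ground M | connect (remove_edge e u v) u (f x)].

Definition decomposition_width M (N : finType) (e : rel N) (f : T -> N) :=
  (\max_(p : N * N | e p.1 p.2) connectivity M (displayed M e f p.1 p.2))%N.

Definition branch_width_at_most M (w : int) :=
  exists (N : finType) (e : rel N) (f : T -> N),
    branch_decomposition M e f /\ (decomposition_width M e f)%:Z <= w.

End Matroid.

Section Configuration.
Context {K : finFieldType} {V : vectType K}.
Implicit Types A : {mset V}.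

(* A multiset is listed with repetitions by its coercion to [seq]; the ground
   set of M(A) is the set of positions in this list. *)
Definition subconfig A (X : {set 'I_(size A)}) : seq V :=
  [seq tnth (in_tuple A) i | i in X].

Definition config_rank A (X : {set 'I_(size A)}) := \dim <<subconfig X>>.

Lemma config_rank_ground A (X : {set 'I_(size A)}) :
  config_rank (X :&: [set: 'I_(size A)]%SET) = config_rank X.
Proof. by rewrite finset.setIT. Qed.

Lemma config_rank_card A (X : {set 'I_(size A)}) : (config_rank X <= #|X|)%N.
Proof. by apply: leq_trans (dim_span _) _; rewrite size_image. Qed.

Lemma subconfigS A (X Y : {set 'I_(size A)}) :
  X \subset Y -> {subset subconfig X <= subconfig Y}.
Proof.
move=> /fintype.subsetP sXY v /fintype.imageP[i Xi ->].
by apply/fintype.imageP; exists i => //; apply: sXY.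
Qed.

Lemma config_rank_mono A (X Y : {set 'I_(size A)}) :
  X \subset Y -> (config_rank X <= config_rank Y)%N.
Proof. by move=> sXY; apply/dimvS/sub_span/subconfigS. Qed.

Lemma config_rank_submod A (X Y : {set 'I_(size A)}) :
  (config_rank (X :|: Y) + config_rank (X :&: Y)
     <= config_rank X + config_rank Y)%N.
Proof.
rewrite /config_rank -[X in (_ <= X)%N]dimv_sum_cap -span_cat.
apply: leq_add; apply: dimvS; last first.
  by rewrite subv_cap !sub_span //; apply: subconfigS;
    rewrite (finset.subsetIl, finset.subsetIr).
apply: sub_span => v /fintype.imageP[i XYi ->]; rewrite mem_cat.
by move: XYi; rewrite inE => /orP[] Zi; apply/orP; [left|right];
  apply/fintype.imageP; exists i.
Qed.

Definition config_matroid A : matroid 'I_(size A) := {|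
  ground := [set: 'I_(size A)]%SET;
  rank := @config_rank A;
  rank_ground := @config_rank_ground A;
  rank_card := @config_rank_card A;
  rank_mono := @config_rank_mono A;
  rank_submod := @config_rank_submod A |}.

Lemma indep_config_matroid A (X : {set 'I_(size A)}) :
  indep (config_matroid A) X = free (subconfig X).
Proof. by rewrite /indep /= finset.subsetT /free size_image. Qed.

Definition points A := num_points (config_matroid A).

Definition density (R : realType) A : R := (points A)%:R / (\dim <<A>>)%:R.

End Configuration.

Section Minors.
Context {K : finFieldType}.

(* A linear map on a subspace U is represented by (the restriction to U of) a
   linear map on the whole ambient space. *)
Definition minor_map (V' V : vectType K) (f : 'Hom(V', V)) (U : {vspace V'})
    (A' : {mset V'}) (A : {mset V}) :=
  [/\ (f @: <<A'>> = <<A>>)%VS,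
      exists2 C : {mset V'}, (C `<=` A')%mset & (lker f :&: U = <<C>>)%VS
    & (A `<=` seq_mset (map f A'))%mset].

Definition config_minor (V V' : vectType K) (A : {mset V}) (A' : {mset V'}) :=
  exists f : 'Hom(V', V), minor_map f <<A'>> A' A.

Record config := Config { cspace : vectType K; cvectors :> {mset cspace} }.

Definition minor_closed (F : config -> Prop) :=
  forall A A' : config, config_minor A A' -> F A' -> F A.

Definition limiting_density (R : realType) (F : config -> Prop) : \bar R :=
  limn_esup (fun n => ereal_sup
    [set x | exists A : config,
       [/\ F A, \dim <<A>> = n & x = (density R A)%:E]]).

Definition pruned_sequence (R : realType) (A : nat -> config) :=
  forall (delta : R) (k : nat), 0 < delta -> (0 < k)%N ->
    exists m, forall n, (m <= n)%N ->
      pruned_matroid delta k (config_matroid (A n)).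

End Minors.
Arguments config : clear implicits.

Section Rooted.
Context {K : finFieldType}.

(* The configuration A* of which A, L and R form a partition is their multiset
   sum, so L and R may share vectors with each other and with A. *)
Definition rooted_axiom (V : vectType K) (A : {mset V}) (L R : seq V) :=
  [&& free L, free R, all [in <<(A : seq V) ++ L>>%VS] R
    & all [in <<(A : seq V) ++ R>>%VS] L].

Record rooted (V : vectType K) := Rooted {
  rbody : {mset V};
  rleft : seq V;
  rright : seq V;
  rootedP : rooted_axiom rbody rleft rright
}.

Definition rspan (V : vectType K) (H : rooted V) : {vspace V} :=
  <<(rbody H : seq V) ++ rleft H ++ rright H>>.

Definition nontrivial (V : vectType K) (H : rooted V) :=
  (\dim <<rleft H>> < \dim (rspan H))%N.

Definition is_patch (q : nat) (V : vectType K) (H : rooted V) :=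
  size (rleft H) = q /\ size (rright H) = q.

Definition rooted_iso (V1 V2 : vectType K) (H1 : rooted V1) (H2 : rooted V2) :=
  exists f : 'Hom(V1, V2),
    [/\ (lker f :&: rspan H1 = 0)%VS, (f @: rspan H1 = rspan H2)%VS,
        seq_mset (map f (rbody H1)) = rbody H2,
        map f (rleft H1) = rleft H2 & map f (rright H1) = rright H2].

(* The map is defined on the span of H', so its whole kernel there, and not
   only the part inside the span of the body, is spanned by contracted
   elements of the body. *)
Definition rooted_minor (V V' : vectType K) (H : rooted V) (H' : rooted V') :=
  exists f : 'Hom(V', V),
    [/\ minor_map f (rspan H') (rbody H') (rbody H),
        map f (rleft H') = rleft H & map f (rright H') = rright H].

Definition linked (V : vectType K) (H : rooted V) :=
  exists (V' : vectType K) (H' : rooted V'),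
    rooted_minor H' H /\ rleft H' = rright H'.

Definition is_product (q : nat) (V : vectType K) (H H1 H2 : rooted V) :=
  [/\ (size (rleft H) <= q)%N /\ (size (rright H) <= q)%N,
      rbody H = (rbody H1 `+` rbody H2)%mset,
      rleft H1 = rleft H /\ rright H2 = rright H,
      rright H1 = rleft H2
    & let W := (<<(rbody H1 : seq V) ++ rleft H>>
                :&: <<(rbody H2 : seq V) ++ rright H>>)%VS in
      (\dim W <= q)%N /\ basis_of W (rright H1)].

(* The product is associative, so nesting to the left loses no generality. *)
Inductive iterated_product (q : nat) (V : vectType K) :
    seq (rooted V) -> rooted V -> Prop :=
| iterated_product1 H : iterated_product q [:: H] H
| iterated_productS Hs H' H'' H :
    iterated_product q Hs H' -> is_product q H H' H'' ->
    iterated_product q (rcons Hs H'') H.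

(* The class P(H_m, ..., H_n), where the product of rooted configurations is
   taken with respect to the bound q. *)
Definition products (q : nat) (V : nat -> vectType K)
    (H : forall j, rooted (V j)) (m n : nat) (W : vectType K) (F : rooted W) :=
  exists G : nat -> rooted W,
    iterated_product q [seq G j | j <- index_iota m n.+1] F /\
    forall j, (m <= j <= n)%N -> rooted_iso (G j) (H j).

End Rooted.

(* Main.v *)
(** Fix a nonprincipal ultrafilter on the indices n.  In a cubic tree, every
    displayed set of rank at least s contains one of rank between s and 2s, so
    from the top down each large A_n contains nested displayed sets of ranks
    about 1, 3, 9, ...: an exponentially growing chain of bounded order.  The
    ranks grow along the chain, but the j-th one is bounded independently of n,
    and that is all that pruning and compactness need.  If infinitely many steps of
    such a chain are crossed (for most n) by a separation of smaller order,
    these separations form a chain of smaller order; so after finitely many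
    descents and after dropping an initial part, every step is unbreakable,
    and matroid intersection (Tutte's linking theorem) yields a contracted set
    linking consecutive boundaries.  Since the members of the chain are flats,
    contracting this set identifies no points outside its layer, and pruning
    bounds the number of points of the layer from below, up to an error that
    vanishes in the limit.  The layers between consecutive flats are the
    patches; each has finitely many isomorphism types, and the types that occur
    for most n form the sequence H_j. *)

Require Import Defs.
From mathcomp Require Import all_boot all_order all_algebra.
From mathcomp Require Import finmap multiset.
From mathcomp Require Import all_classical all_reals all_analysis.
From mathcomp Require Import zify lra.

Set Implicit Arguments.
Unset Strict Implicit.
Unset Printing Implicit Defensive.

Import Order.TTheory GRing.Theory Num.Theory numFieldNormedType.Exports.

Local Open Scope ring_scope.

(** * Points of a matroid *)

Section MatroidPoints.
Context {T : finType}.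
Implicit Types (M : matroid T) (X Y S : {set T}).

(** Induction on [#|Y|]: submodularity is applied to [X :|: Y :\ y] and [y |: X], whose union is
    [X :|: Y] and whose intersection contains [X]. *)
Lemma rank_setU_closed M X Y :
  (forall y, y \in Y -> rank M (y |: X) = rank M X) ->
  rank M (X :|: Y) = rank M X.
Proof.
have [n] := ubnP #|Y|; elim: n Y => // n IHn Y leYn clY.
have [->|[y Yy]] := set_0Vmem Y; first by rewrite finset.setU0.
have rXY : rank M (X :|: Y :\ y) = rank M X.
  apply: IHn => [|z]; first by move: leYn; rewrite (cardsD1 y) Yy.
  by rewrite !inE => /andP[_ /clY].
apply/eqP; rewrite eqn_leq (rank_mono M (finset.subsetUl X Y)) andbT.
have := rank_submod M (X :|: Y :\ y) (y |: X).
have -> : X :|: Y :\ y :|: (y |: X) = X :|: Y.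
  apply/finset.setP => z; rewrite !inE.
  by case: eqVneq => [->|]; rewrite ?Yy /= ?orbT // orbAC orbb.
have : (rank M X <= rank M ((X :|: Y :\ y) :&: (y |: X)))%N.
  by apply: rank_mono; rewrite finset.subsetI !(finset.subsetUl, finset.subsetUr).
rewrite rXY (clY y Yy); lia.
Qed.

(** Each [x] in [S] is sent to the rank-one flat it spans; distinct elements of [S] are not
    parallel, so this map is injective. *)
Lemma leq_card_num_points M S :
  S \subset ground M -> (forall x, x \in S -> rank M [set x] = 1%N) ->
  {in S &, forall x y, x != y -> rank M [set x; y] = 2%N} ->
  (#|S| <= num_points M)%N.
Proof.
move=> /fintype.subsetP sSE rS rSS.
pose cl x := [set y in ground M | rank M [set x; y] == 1%N]%SET.
have clS x : x \in S -> x \in cl x.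
  by move=> Sx; rewrite inE sSE //= finset.setUid rS.
have rcl x : x \in S -> rank M (cl x) = 1%N.
  move=> Sx; rewrite -(rS x Sx) -(@rank_setU_closed M [set x] (cl x)).
    by congr (rank M _); apply/esym/finset.setUidPr; rewrite finset.sub1set clS.
  by move=> y; rewrite inE finset.setUC => /andP[_ /eqP->]; rewrite rS.
rewrite -(@card_in_imset _ _ cl); last first.
  move=> x y Sx Sy exy; apply/eqP/negPn/negP => /(rSS x y Sx Sy) rxy.
  by have := clS y Sy; rewrite -exy inE rxy andbF.
apply/fintype.subset_leq_card/fintype.subsetP => _ /imsetP[x Sx ->].
rewrite inE rcl // eqxx andbT /flat.
apply/andP; split; first by apply/fintype.subsetP => y; rewrite inE => /andP[].
apply/forall_inP => y; rewrite !inE rcl // => /andP[+ Ey]; rewrite Ey /= => ny1.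
have le : (rank M [set x; y] <= rank M (y |: cl x))%N.
  apply: rank_mono; apply/fintype.subsetP => z; rewrite !finset.in_setU !finset.in_set1 orbC.
  by case/orP=> /eqP->; rewrite ?eqxx ?clS ?orbT.
have : (rank M [set x] <= rank M [set x; y])%N by rewrite rank_mono ?finset.subsetUl.
by move: ny1 le; rewrite rS //; lia.
Qed.

(** One non-loop is picked from each rank-one flat. *)
Lemma num_points_transversal M : exists S : {set T},
  [/\ S \subset ground M, forall x, x \in S -> rank M [set x] = 1%N,
      {in S &, forall x y, x != y -> rank M [set x; y] = 2%N}
    & #|S| = num_points M].
Proof.
pose P := [set X | flat M X && (rank M X == 1%N)]%SET.
have Pcl X x y : X \in P -> x \in X -> rank M [set x] = 1%N ->
    y \in ground M -> (rank M [set x; y] <= 1)%N -> y \in X.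
  rewrite inE => /andP[/andP[_ /forall_inP cX] /eqP rX] Xx rx Ey rxy.
  apply/negPn/negP => nXy; have := cX y; rewrite !inE nXy Ey => /(_ isT).
  have := rank_submod M X [set x; y].
  have -> : X :|: [set x; y] = y |: X.
    by rewrite finset.setUA finset.setUC; congr (_ :|: _);
       apply/finset.setUidPl; rewrite finset.sub1set.
  have := @rank_mono _ M [set x] (X :&: [set x; y]).
  by rewrite finset.sub1set !inE Xx eqxx => /(_ isT); lia.
(* A set consisting of loops would have rank 0 by [rank_setU_closed]. *)
have nl X : X \in P -> exists2 x, x \in X & rank M [set x] == 1%N.
  move=> PX; apply/exists_inP; apply: contraT => /exists_inPn nX.
  move: PX; rewrite inE => /andP[_ /eqP rX].
  suff: rank M (finset.set0 :|: X) = rank M finset.set0.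
    by rewrite finset.set0U rX; have := rank_card M finset.set0; rewrite cards0; lia.
  apply: rank_setU_closed => y Xy; rewrite finset.setU0.
  have := nX y Xy; have := rank_card M [set y]; have := rank_card M finset.set0.
  by rewrite cards0 cards1; lia.
pose p (X : {set T}) := [pick x in X | rank M [set x] == 1%N].
have pP X : X \in P -> exists x, [/\ p X = Some x, x \in X & rank M [set x] = 1%N].
  move=> PX; rewrite /p; case: pickP => [x /andP[Xx /eqP]|n0]; first by exists x.
  by have [x Xx r1] := nl X PX; have := n0 x; rewrite /= Xx r1.
have gP X x : X \in P -> x \in X -> x \in ground M.
  by rewrite inE => /andP[/andP[/fintype.subsetP sX _] _] /sX.
(* Two points with parallel non-loops contain each other; this yields both the pairwise rank 2 and
   the injectivity of the choice. *)
have PP X1 X2 x1 x2 : X1 \in P -> X2 \in P -> x1 \in X1 -> x2 \in X2 ->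
    rank M [set x1] = 1%N -> rank M [set x2] = 1%N ->
    (rank M [set x1; x2] <= 1)%N -> X2 \subset X1.
  move=> P1 P2 X1x X2x r1 r2 r12; have X1x2 := Pcl _ _ _ P1 X1x r1 (gP _ _ P2 X2x) r12.
  apply/fintype.subsetP => y X2y; apply: (Pcl _ _ _ P1 X1x2 r2 (gP _ _ P2 X2y)).
  move: (P2); rewrite inE => /andP[_ /eqP <-]; apply: rank_mono.
  by rewrite finset.subUset !finset.sub1set X2x X2y.
exists [set x | [exists X in P, p X == Some x]]%SET; split.
- apply/fintype.subsetP => x; rewrite inE => /exists_inP[X PX /eqP pX].
  by have [z [+ Xx _]] := pP X PX; rewrite pX => -[->]; apply: gP Xx.
- move=> x; rewrite inE => /exists_inP[X PX /eqP pX].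
  by have [z [+ _ r1]] := pP X PX; rewrite pX => -[->].
- move=> x1 x2; rewrite !inE => /exists_inP[X1 P1 /eqP p1] /exists_inP[X2 P2 /eqP p2] ne.
  have [z1 [+ X1x r1]] := pP _ P1; have [z2 [+ X2x r2]] := pP _ P2.
  rewrite p1 p2 => -[e2] [e1]; rewrite -{}e1 in X1x r1; rewrite -{}e2 in X2x r2.
  have := rank_card M [set x1; x2]; rewrite cards2 ne.
  case: (leqP (rank M [set x1; x2]) 1) => [r12|]; last by lia.
  have s21 := PP _ _ _ _ P1 P2 X1x X2x r1 r2 r12.
  rewrite finset.setUC in r12; have s12 := PP _ _ _ _ P2 P1 X2x X1x r2 r1 r12.
  have eX : X1 = X2 by apply/eqP; rewrite finset.eqEsubset s12.
  by move: p1 ne; rewrite eX p2 => -[->]; rewrite eqxx.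
- rewrite -[num_points M]/#|P| -(@card_in_imset _ _ p P); last first.
    move=> X1 X2 P1 P2 e12; have [x [p1 X1x r1]] := pP _ P1.
    have [y [p2 X2x r2]] := pP _ P2; move: p2; rewrite -e12 p1 => -[exy].
    rewrite -{}exy in X2x.
    have r12 : (rank M [set x; x] <= 1)%N by rewrite finset.setUid r1.
    by apply/eqP; rewrite finset.eqEsubset !(PP _ _ x x).
  have injS : injective (@Some T) by move=> x y [].
  rewrite -(card_imset _ injS); apply: eq_card => o; apply/imsetP/imsetP.
    move=> [x]; rewrite inE => /exists_inP[X PX /eqP pX] ->.
    by exists X => //; rewrite pX.
  move=> [X PX ->]; have [x [pX Xx r1]] := pP _ PX; exists x => //.
  by rewrite inE; apply/exists_inP; exists X; rewrite ?pX.
Qed.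

End MatroidPoints.

(** * Points of a configuration *)

Lemma dim_line_add (K : fieldType) (V : vectType K) (P : {vspace V}) x :
  \dim (P + <[x]>)%VS = (\dim P + (x \notin P))%N.
Proof.
have [Px|nPx] := boolP (x \in P).
  by rewrite addn0; congr (\dim _); apply/addv_idPl.
rewrite dimv_disjoint_sum ?dim_vline.
  by congr (_ + _)%N; case: eqVneq nPx => // ->; rewrite mem0v.
apply/eqP; rewrite -subv0; apply/subvP => y /memv_capP[Py /vlineP[k ey]].
move: Py; rewrite {}ey => Pkx; rewrite memv0; have [->|k0] := eqVneq k 0.
  by rewrite scale0r.
by rewrite -[x]scale1r -(mulVf k0) -scalerA memvZ in nPx.
Qed.

Section ConfigPoints.
Local Open Scope mset_scope.
Local Open Scope ring_scope.
Context {K : finFieldType} {V : vectType K}.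
Implicit Types (A : {mset V}) (s : seq V).

(** Representatives of distinct points. They allow points to be counted by vectors instead of by
    positions in the list of [A]. *)
Definition nonparallel s :=
  [/\ uniq s, forall x, x \in s -> x != 0
    & {in s &, forall x y, x != y -> x \notin <[y]>%VS}].

Lemma nonparallel_filter (a : pred V) s : nonparallel s -> nonparallel (seq.filter a s).
Proof.
case=> us s0 ss; split; first exact: filter_uniq.
- by move=> x; rewrite mem_filter => /andP[_ /s0].
- by move=> x y; rewrite !mem_filter => /andP[_ sx] /andP[_ sy]; apply: ss.
Qed.

Lemma span_subconfig1 A (i : 'I_(size A)) :
  (<<subconfig [set i]>> = <[tnth (in_tuple A) i]>)%VS.
Proof.
rewrite -span_seq1; apply: eq_span => x; rewrite inE.
apply/fintype.imageP/eqP => [[j /finset.set1P-> //]|->].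
by exists i; rewrite ?finset.set11.
Qed.

Lemma span_subconfigU A (X Y : {set 'I_(size A)}) :
  (<<subconfig (X :|: Y)>> = <<subconfig X>> + <<subconfig Y>>)%VS.
Proof.
rewrite -span_cat; apply: eq_span => x; rewrite mem_cat.
apply/fintype.imageP/orP => [[i /finset.setUP[] Xi ->]|[]/fintype.imageP[i Xi ->]].
- by left; apply/fintype.imageP; exists i.
- by right; apply/fintype.imageP; exists i.
- by exists i => //; rewrite finset.inE Xi.
- by exists i => //; rewrite finset.inE Xi orbT.
Qed.

Lemma rank_config1 A (i : 'I_(size A)) :
  rank (config_matroid A) [set i] = (tnth (in_tuple A) i != 0).
Proof. by rewrite /= /config_rank span_subconfig1 dim_vline. Qed.

Lemma rank_config2 A (i j : 'I_(size A)) :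
  rank (config_matroid A) [set i; j] =
  ((tnth (in_tuple A) j != 0%R) + (tnth (in_tuple A) i \notin <[tnth (in_tuple A) j]>%VS))%N.
Proof.
by rewrite /= /config_rank span_subconfigU !span_subconfig1 addvC dim_line_add dim_vline.
Qed.

Lemma nonparallel_points A s :
  {subset s <= A} -> nonparallel s -> (size s <= points A)%N.
Proof.
move=> sA [us s0 ss].
(* The matroid lives on positions, and a repeated vector has several; the condition on [index] keeps
   the first. *)
pose S := [set i : 'I_(size A) | (tnth (in_tuple A) i \in s) &&
   (index (tnth (in_tuple A) i) A == i)]%SET.
apply: (@leq_trans #|S|).
  rewrite -(size_image (tnth (in_tuple A))); apply: uniq_leq_size => // x sx.
  have Ax : (index x A < size A)%N by rewrite index_mem sA.
  have ex : tnth (in_tuple A) (Ordinal Ax) = x.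
    by rewrite (tnth_nth 0) /= nth_index ?sA.
  by apply/fintype.imageP; exists (Ordinal Ax); rewrite ?inE ?ex ?sx ?eqxx.
apply: leq_card_num_points; first exact: finset.subsetT.
  by move=> i; rewrite inE => /andP[si _]; rewrite rank_config1 s0.
move=> i j; rewrite !inE => /andP[si /eqP ii] /andP[sj /eqP jj] nij.
rewrite rank_config2 s0 // ss //; apply: contra_neq nij => eij.
by apply: val_inj; rewrite /= -ii -jj eij.
Qed.

Lemma nonparallel_exists A :
  exists s, [/\ {subset s <= A}, nonparallel s & size s = points A].
Proof.
have [S [_ S1 S2 cS]] := num_points_transversal (config_matroid A).
have nz i : i \in S -> tnth (in_tuple A) i != 0.
  by move=> /S1; rewrite rank_config1; case: eqP.
have np i j : i \in S -> j \in S -> i != j ->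
    tnth (in_tuple A) i \notin <[tnth (in_tuple A) j]>%VS.
  by move=> Si Sj /(S2 i j Si Sj); rewrite rank_config2 nz //; case: (_ \notin _).
exists [seq tnth (in_tuple A) i | i in S]; split.
- by move=> x /fintype.imageP[i _ ->]; apply: mem_tnth.
- split.
  + apply/dinjectiveP => i j Si Sj eij; apply/eqP/negPn/negP => /(np i j Si Sj).
    by rewrite eij memv_line.
  + by move=> x /fintype.imageP[i Si ->]; apply: nz.
  + move=> x y /fintype.imageP[i Si ->] /fintype.imageP[j Sj ->] nij.
    by apply: np => //; apply: contraNneq nij => ->.
- by rewrite size_image cS.
Qed.

Lemma uniq_size_vspace (U : {vspace V}) s :
  uniq s -> {subset s <= U} -> (size s <= #|K| ^ \dim U)%N.
Proof.
move=> us sU; pose f v := \row_i coord (vbasis U) i v.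
have finj : {in s &, injective f}.
  move=> x y sx sy /rowP fxy; rewrite (coord_vbasis (sU x sx)) (coord_vbasis (sU y sy)).
  by apply: eq_bigr => i _; have := fxy i; rewrite !mxE => ->.
have ufs : uniq (map f s) by rewrite map_inj_in_uniq.
rewrite -(size_map f) -(card_uniqP ufs).
by apply: leq_trans (max_card _) _; rewrite card_mx mul1n.
Qed.

(** Over a finite field, unboundedly many points force unbounded dimension, and a layer of bounded
    rank has boundedly many points. *)
Lemma leq_points A : (points A <= #|K| ^ \dim <<A>>)%N.
Proof.
have [s [sA [us _ _] <-]] := nonparallel_exists A.
by apply: uniq_size_vspace => // x /sA /memv_span.
Qed.

End ConfigPoints.

(** * Matroid intersection in a vector space *)

Section MatroidIntersection.
Context {K : fieldType} {V : vectType K}.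
Implicit Types (P Q : {vspace V}) (B C : seq V) (a b : pred V).

Lemma dim_submod (U U' X Y : {vspace V}) : (U <= X + Y)%VS -> (U' <= X :&: Y)%VS ->
  (\dim U + \dim U' <= \dim X + \dim Y)%N.
Proof. by move=> sU sU'; rewrite -(dimv_sum_cap X Y) leq_add ?dimvS. Qed.

Lemma span_filterU a b B :
  (<<seq.filter (predU a b) B>> = <<seq.filter a B>> + <<seq.filter b B>>)%VS.
Proof.
rewrite -span_cat; apply: eq_span => x.
by rewrite mem_cat !mem_filter /= -andb_orl.
Qed.

Lemma span_filterS a b B : {in B, forall x, a x -> b x} ->
  (<<seq.filter a B>> <= <<seq.filter b B>>)%VS.
Proof.
by move=> ab; apply: sub_span => x; rewrite !mem_filter => /andP[/[swap] Bx /(ab x Bx) ->].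
Qed.

(** [C] is a common independent set of the two matroids induced on [B] modulo [P] and modulo [Q],
    and the hypothesis is Edmonds' rank condition. By induction on [B], the condition survives the
    deletion or the contraction of the first element. *)
Theorem linear_matroid_intersection B P Q t : uniq B ->
  (forall a, \dim P + \dim Q + t <=
     \dim (P + <<seq.filter a B>>) + \dim (Q + <<seq.filter (predC a) B>>))%N ->
  exists C, [/\ {subset C <= B}, size C = t,
    \dim (P + <<C>>) = (\dim P + t)%N & \dim (Q + <<C>>) = (\dim Q + t)%N].
Proof.
elim: B P Q t => [|e B IHB] P Q t /= => [_ hB|/andP[nBe uB] hB].
  have := hB predT; rewrite /= span_nil !addv0 => ht.
  have -> : t = 0%N by lia.
  by exists [::]; split; rewrite //= span_nil addv0 addn0.
pose del := `[< forall a, (\dim P + \dim Q + t <=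
     \dim (P + <<seq.filter a B>>) + \dim (Q + <<seq.filter (predC a) B>>))%N >].
have IHdel : del -> exists C, [/\ {subset C <= e :: B}, size C = t,
    \dim (P + <<C>>) = (\dim P + t)%N & \dim (Q + <<C>>) = (\dim Q + t)%N].
  move=> /asboolP /(IHB P Q t uB)[C [sC szC PC QC]]; exists C; split => // x /sC.
  by rewrite inE orbC => ->.
have fB a b : {in B, a =1 b} -> seq.filter a B = seq.filter b B by apply: eq_in_filter.
have ne x : x \in B -> (x == e) = false by apply: contraTF => /eqP->.
(* An element of [P] or of [Q] is a loop of one of the matroids; put on the side where it adds no
   rank, it can be deleted. *)
have [Pe|nPe] := boolP (e \in P).
  apply: IHdel; apply/asboolP => a; have := hB (predU1 e a).
  rewrite /= eqxx /= span_cons addvA (addv_idPl Pe).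
  rewrite (fB (predU1 e a) a) ?(fB (predC (predU1 e a)) (predC a)) //.
    by move=> x Bx /=; rewrite ne.
  by move=> x Bx /=; rewrite ne.
have [Qe|nQe] := boolP (e \in Q).
  apply: IHdel; apply/asboolP => a; have := hB (predD1 a e).
  rewrite /= eqxx /= span_cons addvA (addv_idPl Qe).
  rewrite (fB (predD1 a e) a) ?(fB (predC (predD1 a e)) (predC a)) //.
    by move=> x Bx /=; rewrite ne.
  by move=> x Bx /=; rewrite ne.
have [/IHdel//|/asboolPn/existsNP[a1 /negP]] := boolP del; rewrite -ltnNge => ha1.
have dPe : \dim (P + <[e]>) = (\dim P).+1 by rewrite dim_line_add nPe addn1.
have dQe : \dim (Q + <[e]>) = (\dim Q).+1 by rewrite dim_line_add nQe addn1.
have t_gt0 : (0 < t)%N.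
  move: ha1; have := dimvS (addvSl P <<seq.filter a1 B>>).
  by have := dimvS (addvSl Q <<seq.filter (predC a1) B>>); lia.
(* Contracting [e] adds it to both [P] and [Q] and lowers [t] by one. *)
have [hc|] := pselect (forall a, (\dim (P + <[e]>) + \dim (Q + <[e]>) + t.-1 <=
     \dim (P + <[e]> + <<seq.filter a B>>) + \dim (Q + <[e]> + <<seq.filter (predC a) B>>))%N).
  have [C [sC szC PC QC]] := IHB _ _ _ uB hc; exists (e :: C); split.
  - by move=> x; rewrite !inE => /orP[->//|/sC ->]; rewrite orbT.
  - by rewrite /= szC prednK.
  - by rewrite span_cons addvA PC dPe; lia.
  - by rewrite span_cons addvA QC dQe; lia.
(* [a1] and [a2] violate the rank condition for the deletion and contraction
   of [e]; uncrossing them violates it for [B]. *)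
move=> /existsNP[a2 /negP]; rewrite -ltnNge dPe dQe => ha2.
have := hB (predU1 e (predU a1 a2)); have := hB (predD1 (predI a1 a2) e).
rewrite /= !eqxx /= !span_cons.
rewrite (fB (predU1 e (predU a1 a2)) (predU a1 a2)); last by move=> x Bx /=; rewrite ne.
rewrite (fB (predC (predU1 e (predU a1 a2))) (predC (predU a1 a2))); last first.
  by move=> x Bx /=; rewrite ne.
rewrite (fB (predD1 (predI a1 a2) e) (predI a1 a2)); last by move=> x Bx /=; rewrite ne.
rewrite (fB (predC (predD1 (predI a1 a2) e)) (predC (predI a1 a2))); last first.
  by move=> x Bx /=; rewrite ne.
have s1 : (\dim (P + (<[e]> + <<seq.filter (predU a1 a2) B>>)) +
    \dim (P + <<seq.filter (predI a1 a2) B>>) <=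
    \dim (P + <<seq.filter a1 B>>) + \dim (P + <[e]> + <<seq.filter a2 B>>))%N.
  apply: dim_submod.
    rewrite span_filterU !subv_add; apply/and4P; split.
    - exact: subv_trans (addvSl _ _) (addvSl _ _).
    - by apply: subv_trans (addvSr _ _); apply: subv_trans (addvSl _ _); apply: addvSr.
    - by apply: subv_trans (addvSl _ _); apply: addvSr.
    - by apply: subv_trans (addvSr _ _); apply: addvSr.
  rewrite subv_cap !addvS ?addvSl //.
    by apply: span_filterS => x _ /andP[].
  by apply: span_filterS => x _ /andP[].
have s2 : (\dim (Q + (<[e]> + <<seq.filter (predC (predI a1 a2)) B>>)) +
    \dim (Q + <<seq.filter (predC (predU a1 a2)) B>>) <=
    \dim (Q + <<seq.filter (predC a1) B>>) + \dim (Q + <[e]> + <<seq.filter (predC a2) B>>))%N.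
  apply: dim_submod.
    rewrite (eq_filter (a2 := predU (predC a1) (predC a2))); last first.
      by move=> x /=; rewrite negb_and.
    rewrite span_filterU !subv_add; apply/and4P; split.
    - exact: subv_trans (addvSl _ _) (addvSl _ _).
    - by apply: subv_trans (addvSr _ _); apply: subv_trans (addvSl _ _); apply: addvSr.
    - by apply: subv_trans (addvSl _ _); apply: addvSr.
    - by apply: subv_trans (addvSr _ _); apply: addvSr.
  rewrite subv_cap !addvS ?addvSl //.
    by apply: span_filterS => x _ /=; rewrite negb_or => /andP[].
  by apply: span_filterS => x _ /=; rewrite negb_or => /andP[].
(* With [S = dim P + dim Q + t], the two violations sum to at most [2 S - 1], the two instances of
   [hB] to at least [2 S]. *)
by move: s1 s2 ha1 ha2; lia.
Qed.

End MatroidIntersection.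

(** * Displayed sets of bounded rank *)

Section BranchDecomposition.
Context {T : finType} (M : matroid T) (N : finType) (e : rel N) (f : T -> N).
Hypothesis tree_e : is_tree e.
Hypothesis cubic_e : forall v, degree e v = 1%N \/ degree e v = 3%N.
Hypothesis leaf_f : {in ground M, forall x, degree e (f x) = 1%N}.
Hypothesis inj_f : {in ground M &, injective f}.

Let comp u v := [set x | connect (remove_edge e u v) u x]%SET.
Let D u v := displayed M e f u v.

Let sym_e : symmetric e. Proof. by case: tree_e. Qed.
Let irr_e : irreflexive e. Proof. by case: tree_e. Qed.

(** The hypothesis concerns reachable vertices only, because after deleting one tree edge another
    edge can be avoided only there. *)
Lemma connect_homo_from (r r' : rel N) a x :
  (forall y z, connect r a y -> r y z -> r' y z) -> connect r a x -> connect r' a x.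
Proof.
move=> rr' /connectP[p pp ->]; elim/last_ind: p pp => [|p z IHp]; first by [].
rewrite rcons_path last_rcons => /andP[pp rz]; apply: connect_trans (IHp pp) _.
by apply/connect1/rr' => //; apply/connectP; exists p.
Qed.

Lemma remove_edgeW u v x y : remove_edge e u v x y -> e x y.
Proof. by case/andP => /andP[]. Qed.

Lemma remove_edge_avoid u v x y : e x y -> x != u -> y != u -> remove_edge e u v x y.
Proof.
by move=> exy nxu nyu; rewrite /remove_edge /= exy !xpair_eqE negb_and nxu /= negb_and nyu orbT.
Qed.

Lemma remove_edgeC u v : remove_edge e u v =2 remove_edge e v u.
Proof. by move=> x y; rewrite /remove_edge /= andbAC. Qed.

(** A simple path from [u] to [v] that avoids the edge [uv] would close up with it to a cycle of
    length at least 3. *)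
Lemma acyclic_comp u v : e u v -> v \notin comp u v.
Proof.
move=> euv; rewrite inE; apply/negP => /connectP[p0 pp0].
case/shortenP: pp0 => p pp up _ ev.
have [_ _ _ _ /(_ (u :: p))] := tree_e; rewrite /ucycle up andbT /= rcons_path.
rewrite -ev sym_e euv andbT (sub_path _ pp); last exact: remove_edgeW.
move=> /(_ isT); case: p pp up ev => [|a [|//]] /=.
  by move=> _ _ evu _; move: euv; rewrite evu irr_e.
by move=> /andP[r _] _ ev _; move: r; rewrite ev /remove_edge /= eqxx andbF.
Qed.

Lemma avoid_path u a p : path e a p -> u \notin a :: p -> connect (remove_edge e a u) a (last a p).
Proof.
move=> pp nu; apply/connectP; exists p => //.
have : {in predC1 u &, subrel e (remove_edge e a u)}.
  by move=> x y xu yu exy; rewrite remove_edgeC remove_edge_avoid.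
move=> /sub_in_path; apply => //.
by apply/allP => x xp; apply: contraNneq nu => <-.
Qed.

(** A walk from [a] avoiding the edge [au] never reaches [u], by [acyclic_comp], so it never uses
    [uv]; the edge [ua] joins it to [u]. *)
Lemma sub_comp u v a : e u v -> e u a -> a != v -> comp a u \subset comp u v.
Proof.
move=> euv eua nav; apply/fintype.subsetP => x; rewrite !inE => cx.
have ea : remove_edge e u v u a.
  rewrite /remove_edge /= eua !xpair_eqE eqxx nav /= negb_and.
  by apply/orP; left; apply: contraTneq euv => ->; rewrite irr_e.
apply: connect_trans (connect1 ea) _.
apply: connect_homo_from cx => y z cy ryz.
have := acyclic_comp (u := a) (v := u); rewrite sym_e eua inE => /(_ isT) nu.
apply: remove_edge_avoid (remove_edgeW ryz) _ _.
  by apply: contraNneq nu => eyu; rewrite eyu in cy.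
by apply: contraNneq nu => ezu; rewrite ezu in ryz; apply: connect_trans cy (connect1 ryz).
Qed.

Lemma comp_sub u v x : x \in comp u v ->
  x = u \/ exists a, [/\ e u a, a != v & x \in comp a u].
Proof.
rewrite inE => /connectP[p0 pp0 ->]; case/shortenP: pp0 => -[|a p] /=; first by left.
move=> /andP[ra pp] /andP[nu _] _; right; exists a; split.
- exact: remove_edgeW ra.
- by apply: contraTneq ra => ->; rewrite /remove_edge /= eqxx andbF.
- by rewrite inE; apply: avoid_path => //; apply: sub_path pp; apply: remove_edgeW.
Qed.

Lemma comp_cover u v x : e u v -> x \in comp u v \/ x \in comp v u.
Proof.
move=> euv; have [_ _ _ /(_ u x) + _] := tree_e => /connectP[p0 pp0 ->].
case/shortenP: pp0 => -[|a p] /=; first by left; rewrite inE.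
move=> /andP[ea pp] /andP[nu _] _; have [<-|nav] := eqVneq a v.
  by right; rewrite inE; apply: avoid_path.
left; apply: (fintype.subsetP (sub_comp euv ea nav)).
by rewrite inE; apply: avoid_path.
Qed.

Lemma mem_D u v x : (x \in D u v) = (x \in ground M) && (f x \in comp u v).
Proof. by rewrite !inE. Qed.

Lemma rank_setU_le X Y : (rank M (X :|: Y) <= rank M X + rank M Y)%N.
Proof. exact: leq_trans (leq_addr _ _) (rank_submod _ _ _). Qed.

(** Descend away from [uv]. At a leaf the displayed set has at most one element. At a cubic vertex
    it is covered by the sets displayed at the two other edges, so rank above [2 * s] leaves rank at
    least [s] in one of them, whose component is smaller. *)
Lemma displayed_descent s u v : (0 < s)%N -> e u v -> (s <= rank M (D u v))%N ->
  exists a b, [/\ e a b, D a b \subset D u v & (s <= rank M (D a b) <= 2 * s)%N].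
Proof.
move=> s_gt0; have [n] := ubnP #|comp u v|; elim: n u v => // n IHn u v lt_n euv les.
have [le2s|gt2s] := leqP (rank M (D u v)) (2 * s).
  by exists u, v; rewrite les le2s fintype.subxx.
have [du|du] := cubic_e u.
  have /cards1P[v' ev'] : #|[set a | e u a]%SET| == 1%N by apply/eqP.
  have {ev'} ev a : e u a -> a = v.
    move=> eua; have /finset.setP/(_ a) := ev'; have /finset.setP/(_ v) := ev'.
    by rewrite !inE euv eua => /esym/eqP-> /esym/eqP.
  have : (rank M (D u v) <= 1)%N; last by lia.
  apply: leq_trans (rank_card _ _) _.
  apply/card_le1_eqP => x y; rewrite !mem_D => /andP[Ex cx] /andP[Ey cy].
  apply: inj_f => //.
  case: (comp_sub cx) => [->|[a [/ev-> ]]]; last by rewrite eqxx.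
  by case: (comp_sub cy) => [->//|[a [/ev-> ]]]; rewrite eqxx.
have vN : v \in [set a | e u a]%SET by rewrite inE.
have /cards2P[a [b [nab eab]]] : #|[set a | e u a]%SET :\ v| == 2.
  by move: du; rewrite /degree (cardsD1 v) vN add1n => -[->].
have ev c : (c != v) && e u c = (c == a) || (c == b).
  by have /finset.setP/(_ c) := eab; rewrite !inE.
have Dsub c : c \in [set a; b]%SET -> [/\ e c u, D c u \subset D u v & (#|comp c u| < n)%N].
  rewrite !inE -ev => /andP[cv euc]; have ecu : e c u by rewrite sym_e.
  have scomp := sub_comp euv euc cv; split => //.
    by apply/fintype.subsetP => x; rewrite !mem_D => /andP[-> /(fintype.subsetP scomp)].
  apply: leq_trans (proper_card _) (lt_n : (#|comp u v| <= n)%N).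
  apply/fintype.properP; split=> //; exists u; first by rewrite inE.
  exact: acyclic_comp.
have [eau sau na] := Dsub a (finset.set21 _ _).
have [ebu sbu nb] := Dsub b (finset.set22 _ _).
have DU : D u v \subset D a u :|: D b u.
  apply/fintype.subsetP => x; rewrite finset.in_setU !mem_D => /andP[Ex cx]; rewrite Ex /=.
  case: (comp_sub cx) => [fx|[c [euc ncv cc]]].
    (* Elements label leaves only, so none is lost at the cubic vertex [u]. *)
    by have := leaf_f Ex; rewrite fx du.
  by have := ev c; rewrite ncv euc => /esym/orP[] /eqP <-; rewrite cc ?orbT.
have le2 := leq_trans (rank_mono M DU) (rank_setU_le _ _).
have [lea|lea] := leqP s (rank M (D a u)).
  have [a' [b' [e' s' r']]] := IHn _ _ na eau lea.
  by exists a', b'; split=> //; apply: fintype.subset_trans sau.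
have leb : (s <= rank M (D b u))%N by lia.
have [a' [b' [e' s' r']]] := IHn _ _ nb ebu leb.
by exists a', b'; split=> //; apply: fintype.subset_trans sbu.
Qed.

(** The two sides of an edge cover the ground set; the edge at a labelled leaf is taken. *)
Lemma displayed_large s : (2 * s < mrank M)%N ->
  exists u v, e u v /\ (s <= rank M (D u v))%N.
Proof.
move=> lts; have [E0|[x Ex]] := set_0Vmem (ground M).
  by have := rank_card M (ground M); move: lts; rewrite /mrank E0 cards0; lia.
have /cards1P[v ev] : #|[set a | e (f x) a]%SET| == 1%N by apply/eqP/leaf_f.
have /finset.setP/(_ v) := ev; rewrite !inE eqxx => euv.
have : (mrank M <= rank M (D (f x) v :|: D v (f x)))%N.
  apply: rank_mono; apply/fintype.subsetP => y Ey; rewrite finset.in_setU !mem_D Ey.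
  by apply/orP; apply: comp_cover.
have := rank_setU_le (D (f x) v) (D v (f x)).
have [le1|lt1] := leqP s (rank M (D (f x) v)); first by exists (f x), v.
by exists v, (f x); rewrite sym_e; split => //; lia.
Qed.

End BranchDecomposition.

(** Built from the top, by repeating [displayed_descent] inside the set found last. The ranges from
    [3 ^ j] to [2 * 3 ^ j] are disjoint, so ranks strictly increase. *)
Lemma branch_width_chain (T : finType) (M : matroid T) w m :
  branch_width_at_most M w -> (2 * 3 ^ m < mrank M)%N ->
  exists X : nat -> {set T}, forall j, (j <= m)%N ->
    [/\ X j \subset ground M, (3 ^ j <= rank M (X j) <= 2 * 3 ^ j)%N,
        (connectivity M (X j) <= `|w|)%N & (j < m)%N -> X j \subset X j.+1].
Proof.
case=> N [e [f [[te ce lf jf] dw]]] /(displayed_large te lf)[u [v [euv les]]].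
have con a b : e a b -> (connectivity M (displayed M e f a b) <= `|w|)%N.
  move=> eab; have : (connectivity M (displayed M e f a b) <= decomposition_width M e f)%N.
    by rewrite /decomposition_width (leq_bigmax_cond (a, b)).
  by lia.
suff H : forall u v, e u v -> (3 ^ m <= rank M (displayed M e f u v))%N ->
    exists X : nat -> {set T}, forall j, (j <= m)%N ->
    [/\ X j \subset displayed M e f u v, (3 ^ j <= rank M (X j) <= 2 * 3 ^ j)%N,
        (connectivity M (X j) <= `|w|)%N & (j < m)%N -> X j \subset X j.+1].
  have [X XP] := H u v euv les; exists X => j /XP[sX ? ? ?]; split => //.
  by apply: fintype.subset_trans sX _; apply/fintype.subsetP => x; rewrite inE => /andP[].
elim: m {u v euv les} => [|m IHm] u v euv les.
  have [a [b [eab sab rab]]] := displayed_descent te ce lf jf (ltn0Sn 0) euv les.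
  by exists (fun=> displayed M e f a b) => j; rewrite leqn0 => /eqP->; split=> //; apply: con.
have s_gt0 : (0 < 3 ^ m.+1)%N by rewrite expn_gt0.
have [a [b [eab sab rab]]] := displayed_descent te ce lf jf s_gt0 euv les.
have lem : (3 ^ m <= rank M (displayed M e f a b))%N.
  by case/andP: rab => + _; apply: leq_trans; rewrite leq_pexp2l.
have [X XP] := IHm a b eab lem.
exists (fun j => if (j <= m)%N then X j else displayed M e f a b) => j lej.
have [lejm|ltmj] := leqP j m; last first.
  have -> : j = m.+1 by lia.
  by split=> //; [apply: con | rewrite ltnn].
have [sX rX cX nX] := XP j lejm; split=> //; first exact: fintype.subset_trans sX sab.
by case: (ltnP j m) => [/nX//|_ _].
Qed.

(** * Separations of a configuration *)

Section Separations.
Local Open Scope mset_scope.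
Local Open Scope ring_scope.
Context {K : finFieldType} {V : vectType K}.
Implicit Types (A B : {mset V}) (P Q U : {vspace V}) (s C : seq V).

(** Such subspaces stand for the flats of the matroid of [A]. *)
Definition spanned A P := <<[seq v <- A | v \in P]>>%VS = P.
Definition outer A P : {vspace V} := <<[seq v <- A | v \notin P]>>%VS.
(** For a flat [P], the dimension of this space is the connectivity minus one, called the order
    below. *)
Definition boundary A P := (P :&: outer A P)%VS.
(** Repetitions are removed: the number of points is unchanged, and bounded rank then leaves
    finitely many isomorphism types. *)
Definition layer A P Q : {mset V} :=
  seq_mset [seq v <- undup A | (v \in Q) && (v \notin P)].

Lemma seq_mset_subset s B : uniq s -> {subset s <= B} -> (seq_mset s `<=` B)%mset.
Proof.
move=> us sB; apply/msubsetP => x; rewrite mset_seqE count_uniq_mem //.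
by case: (boolP (x \in s)) => [/sB|//]; rewrite in_mset.
Qed.

Lemma span_seq_mset s : (<<(seq_mset s : seq V)>> = << s >>)%VS.
Proof. exact/eq_span/perm_mem/perm_eq_seq_mset. Qed.

Lemma mem_layer A P Q v : (v \in layer A P Q) = [&& v \in A, v \in Q & v \notin P].
Proof.
by rewrite (perm_mem (perm_eq_seq_mset _)) mem_filter mem_undup andbC.
Qed.

Lemma layer_uniq A P Q : uniq (layer A P Q).
Proof. by rewrite (perm_uniq (perm_eq_seq_mset _)) filter_uniq ?undup_uniq. Qed.

Lemma layer_sub A P Q : (layer A P Q `<=` A)%mset.
Proof.
apply: seq_mset_subset; first by rewrite filter_uniq ?undup_uniq.
by move=> v; rewrite mem_filter mem_undup => /andP[].
Qed.

Lemma layerD A P Q U : (P <= Q)%VS -> (Q <= U)%VS ->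
  (layer A P U = layer A P Q `+` layer A Q U)%mset.
Proof.
move=> /subvP sPQ /subvP sQU; apply/msetP => x; rewrite msetE2 !mset_seqE.
rewrite !count_uniq_mem ?filter_uniq ?undup_uniq // !mem_filter.
case: (x \in undup A); rewrite ?andbF ?andbT //.
have /implyP := sPQ x; have /implyP := sQU x.
by case: (x \in P); case: (x \in Q); case: (x \in U).
Qed.

Lemma outerS A P Q : (P <= Q)%VS -> (outer A Q <= outer A P)%VS.
Proof.
move=> /subvP sPQ; apply: sub_span => x; rewrite !mem_filter => /andP[nQx ->].
by rewrite andbT; apply: contra nQx => /sPQ.
Qed.

Lemma mem_outer A P x : x \in A -> x \notin P -> x \in outer A P.
Proof. by move=> Ax nPx; apply: memv_span; rewrite mem_filter nPx. Qed.

Lemma span_layer_sub A P Q : (<<(layer A P Q : seq V)>> <= Q)%VS.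
Proof. by apply/span_subvP => x; rewrite mem_layer => /and3P[]. Qed.

Lemma span_layer_outer A P Q : (<<(layer A P Q : seq V)>> <= outer A P)%VS.
Proof. by apply/span_subvP => x; rewrite mem_layer => /and3P[Ax _]; apply: mem_outer. Qed.

Lemma add_outer A P : spanned A P -> (P + outer A P = <<(A : seq V)>>)%VS.
Proof.
move=> {1}<-; rewrite -span_cat; apply: eq_span => x; rewrite mem_cat !mem_filter.
by rewrite -andb_orl orbN.
Qed.

Lemma add_layer A P Q : spanned A P -> spanned A Q -> (P <= Q)%VS ->
  (P + <<(layer A P Q : seq V)>> = Q)%VS.
Proof.
move=> sP sQ sPQ; apply/eqP; rewrite eqEsubv subv_add sPQ span_layer_sub /=.
rewrite -{1}sQ; apply/span_subvP => x; rewrite mem_filter => /andP[Qx Ax].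
have [Px|nPx] := boolP (x \in P); first exact: (subvP (addvSl _ _)).
by apply: (subvP (addvSr _ _)); apply: memv_span; rewrite mem_layer Ax Qx.
Qed.

Lemma add_layer_outer A P Q : (P <= Q)%VS ->
  (<<(layer A P Q : seq V)>> + outer A Q = outer A P)%VS.
Proof.
move=> sPQ; apply/eqP; rewrite eqEsubv subv_add span_layer_outer outerS //=.
apply/span_subvP => x; rewrite mem_filter => /andP[nPx Ax].
have [Qx|nQx] := boolP (x \in Q); last first.
  by apply: (subvP (addvSr _ _)); apply: mem_outer.
by apply: (subvP (addvSl _ _)); apply: memv_span; rewrite mem_layer Ax Qx.
Qed.

(** Modular law: the layer lies in [outer A P] and spans [Q] together with [P]. *)
Lemma layer_boundaryl A P Q : spanned A P -> spanned A Q -> (P <= Q)%VS ->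
  (<<(layer A P Q : seq V)>> + boundary A P = Q :&: outer A P)%VS.
Proof.
move=> sP sQ sPQ; rewrite /boundary vspace_modl ?span_layer_outer //.
by rewrite addvC add_layer.
Qed.

(** The dual form: the layer lies in [Q] and spans [outer A P] together with [outer A Q]. *)
Lemma layer_boundaryr A P Q : (P <= Q)%VS ->
  (<<(layer A P Q : seq V)>> + boundary A Q = Q :&: outer A P)%VS.
Proof.
move=> sPQ; rewrite /boundary capvC vspace_modl ?span_layer_sub //.
by rewrite add_layer_outer // capvC.
Qed.

Lemma dim_boundary A P : spanned A P ->
  (\dim <<(A : seq V)>> + \dim (boundary A P) = \dim P + \dim (outer A P))%N.
Proof. by move=> sP; rewrite -(add_outer sP) dimv_sum_cap. Qed.

Lemma dim_layer_span A P Q : spanned A P -> spanned A Q -> (P <= Q)%VS ->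
  \dim (Q :&: outer A P) = (\dim Q - \dim P + \dim (boundary A P))%N.
Proof.
move=> sP sQ sPQ; have := dim_boundary sP; have := dimv_sum_cap Q (outer A P).
have -> : (Q + outer A P)%VS = <<(A : seq V)>>%VS.
  apply/eqP; rewrite eqEsubv -{2}(add_outer sP) addvS // subv_add andbT.
  apply/andP; split; first by rewrite -{1}sQ; apply: sub_span => x; rewrite mem_filter => /andP[].
  by apply: sub_span => x; rewrite mem_filter => /andP[].
have := dimvS sPQ; lia.
Qed.

(** The span of [C] is a complement of [P] in [Q] and of [outer A Q] in [outer A P], so contracting
    [C] merges the two boundaries without collapsing either. *)
Definition linking A P Q C :=
  [/\ {subset C <= layer A P Q}, (P :&: <<C>> = 0)%VS, (outer A Q :&: <<C>> = 0)%VS,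
      (P + <<C>> = Q)%VS & (outer A Q + <<C>> = outer A P)%VS].

Lemma dim_add_disjoint P Q : \dim (P + Q) = (\dim P + \dim Q)%N -> (P :&: Q = 0)%VS.
Proof.
move=> dPQ; apply/eqP; rewrite -dimv_eq0; have := dimv_sum_cap P Q; rewrite dPQ.
by move=> /eqP; rewrite -{2}[(\dim P + _)%N]addn0 eqn_add2l.
Qed.

(** Tutte's linking theorem from matroid intersection modulo [P] and [outer A Q]. A part of the
    layer spans with [P] a flat [U] between [P] and [Q], and the lower bound on its order is the
    rank condition for that part. *)
Lemma linking_exists A P Q q :
  spanned A P -> spanned A Q -> (P <= Q)%VS ->
  (\dim P + \dim (outer A P) = \dim <<(A : seq V)>> + q)%N ->
  (\dim Q + \dim (outer A Q) = \dim <<(A : seq V)>> + q)%N ->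
  (forall U, spanned A U -> (P <= U)%VS -> (U <= Q)%VS ->
    \dim <<(A : seq V)>> + q <= \dim U + \dim (outer A U))%N ->
  exists C, linking A P Q C.
Proof.
move=> sP sQ sPQ dP dQ dU; pose B : seq V := layer A P Q; pose t := (\dim Q - \dim P)%N.
have lePQ := dimvS sPQ.
have [|a|C [sC szC PC QC]] := @linear_matroid_intersection _ _ B P (outer A Q) t.
- exact: layer_uniq.
- pose U : {vspace V} := (P + <<seq.filter a B>>)%VS.
  have sPU : (P <= U)%VS by apply: addvSl.
  have sUQ : (U <= Q)%VS.
    rewrite subv_add sPQ; apply/span_subvP => x; rewrite mem_filter => /andP[_].
    by rewrite mem_layer => /and3P[].
  have sU : spanned A U.
    apply/eqP; rewrite eqEsubv; apply/andP; split.
      by apply/span_subvP => x; rewrite mem_filter => /andP[].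
    rewrite subv_add; apply/andP; split.
      rewrite -{1}sP; apply: sub_span => x; rewrite !mem_filter => /andP[Px ->].
      by rewrite (subvP sPU).
    apply/span_subvP => x xB; apply: memv_span; rewrite mem_filter.
    rewrite (subvP (addvSr _ _)) ?memv_span //.
    by move: xB; rewrite mem_filter mem_layer => /and4P[].
  (* A layer vector outside [U] belongs to the complementary part. *)
  have sO : (outer A U <= outer A Q + <<seq.filter (predC a) B>>)%VS.
    apply/span_subvP => x; rewrite mem_filter => /andP[nUx Ax].
    have [Qx|nQx] := boolP (x \in Q); last first.
      by apply: (subvP (addvSl _ _)); apply: mem_outer.
    apply: (subvP (addvSr _ _)); apply: memv_span.
    have nPx : x \notin P by apply: contra nUx; apply/subvP.
    rewrite mem_filter mem_layer Ax Qx nPx !andbT /=.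
    apply: contra nUx => ax; apply: (subvP (addvSr _ _)); apply: memv_span.
    by rewrite mem_filter ax mem_layer Ax Qx nPx.
  have := dU U sU sPU sUQ; have := dimvS sO; rewrite -/U /t; lia.
have dC : \dim <<C>> = t.
  have := dim_span C; rewrite szC; have := dimv_sum_cap P <<C>>; rewrite PC; lia.
have sCQ : (<<C>> <= Q)%VS.
  by apply/span_subvP => x /sC; rewrite mem_layer => /and3P[].
have sCP : (<<C>> <= outer A P)%VS.
  by apply/span_subvP => x /sC; rewrite mem_layer => /and3P[Ax _]; apply: mem_outer.
exists C; split=> //.
- by apply: dim_add_disjoint; rewrite dC.
- by apply: dim_add_disjoint; rewrite dC.
- by apply/eqP; rewrite eqEdim subv_add sPQ sCQ PC /t; lia.
- by apply/eqP; rewrite eqEdim subv_add outerS // sCP QC /t; lia.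
Qed.

Lemma dim_linking A P Q C : linking A P Q C -> \dim Q = (\dim P + \dim <<C>>)%N.
Proof. by case=> _ PC _ <- _; rewrite dimv_disjoint_sum. Qed.

Lemma daddv_pi_eq0 P Q w : (P :&: Q = 0)%VS -> w \in (P + Q)%VS ->
  (daddv_pi P Q w == 0) = (w \in Q).
Proof.
move=> PQ0 /(daddv_pi_add PQ0) ew; apply/eqP/idP => [w0|Qw].
  by rewrite -ew w0 add0r memv_pi.
move: ew; rewrite [X in _ + X]daddv_pi_id //; last by rewrite capvC.
by move=> /(canRL (addrK _)); rewrite subrr.
Qed.

Lemma complement_exists U s :
  exists C, [/\ {subset C <= s}, uniq C, (U :&: <<C>> = 0)%VS & (U + <<C>> = U + << s >>)%VS].
Proof.
elim: s => [|x s [C [sC uC UC UCs]]].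
  by exists [::]; rewrite span_nil capv0.
have [Ux|nUx] := boolP (x \in U + <<C>>)%VS.
  exists C; split=> //; first by move=> y /sC; rewrite inE orbC => ->.
  rewrite span_cons addvA (addvC U <[x]>%VS) -addvA -UCs; apply/esym/addv_idPr.
  by rewrite -memvE.
exists (x :: C); split.
- by move=> y; rewrite !inE => /orP[->//|/sC ->]; rewrite orbT.
- rewrite /= uC andbT; apply: contra nUx => Cx.
  by apply: (subvP (addvSr _ _)); apply: memv_span.
- apply: dim_add_disjoint; rewrite !span_cons addvA (addvC U <[x]>%VS) -addvA addvC dim_line_add nUx.
  rewrite [(<[x]> + <<C>>)%VS]addvC dim_line_add dimv_disjoint_sum //.
  by rewrite (contra _ nUx) ?addnA //; apply/subvP/addvSr.
- by rewrite !span_cons !addvA !(addvC U <[x]>%VS) -!addvA UCs.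
Qed.

(** Deletion may lower the rank, while a minor map must be onto the span of [B]. So a complement of
    that span, generated by vectors of [A], is contracted; the projection along it fixes [B]. *)
Lemma submset_minor A B : (B `<=` A)%mset -> config_minor B A.
Proof.
move=> sBA; have sBA' : {subset B <= A} by apply: msubset_subset.
have [C [sC uC BC BCA]] := complement_exists <<(B : seq V)>> A.
have {}BCA : (<<(B : seq V)>> + <<C>> = <<(A : seq V)>>)%VS.
  by rewrite BCA; apply/addv_idPr/sub_span.
exists (daddv_pi <<B>> <<C>>); split.
- apply/vspaceP => x; apply/memv_imgP/idP => [[y _ ->]|Bx]; first exact: memv_pi.
  by exists x; [rewrite -BCA (subvP (addvSl _ _))|rewrite daddv_pi_id].
- exists (seq_mset C); first exact: seq_mset_subset.
  rewrite span_seq_mset; apply/vspaceP => x; rewrite memv_cap memv_ker -BCA.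
  apply/andP/idP => [[x0 BCx]|Cx]; first by rewrite -(daddv_pi_eq0 BC).
  have BCx : x \in (<<B>> + <<C>>)%VS by apply: (subvP (addvSr _ _)).
  by rewrite daddv_pi_eq0.
- apply/msubsetP => x; rewrite mset_seqE count_map.
  have [Bx|/mset_eq0P->//] := boolP (x \in B).
  apply: leq_trans (_ : (A x <= _)%N); first exact: (msubsetP sBA).
  rewrite -count_mem_mset; apply: sub_count => y /= /eqP->.
  by rewrite daddv_pi_id // memv_span.
Qed.

End Separations.

(** * Patches *)

Section Patches.
Local Open Scope mset_scope.
Local Open Scope ring_scope.
Context {K : finFieldType} {V : vectType K}.
Implicit Types (A B : {mset V}) (P Q U : {vspace V}) (s C L R : seq V).

Lemma rooted_axiom0 : rooted_axiom (mset0 : {mset V}) [::] [::].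
Proof. by rewrite /rooted_axiom nil_free. Qed.

(** Total constructor, with the empty rooted configuration as default, so that segments can be
    defined before their axiom is established. *)
Definition mk_rooted A L R : rooted V :=
  match @idP (rooted_axiom A L R) with
  | ReflectT h => Rooted h
  | ReflectF _ => Rooted rooted_axiom0
  end.

Lemma mk_rootedE A L R : rooted_axiom A L R ->
  [/\ rbody (mk_rooted A L R) = A, rleft (mk_rooted A L R) = L
    & rright (mk_rooted A L R) = R].
Proof. by rewrite /mk_rooted; case: {-}_ / idP. Qed.

Lemma span_layer_basisl A P Q L : spanned A P -> spanned A Q -> (P <= Q)%VS ->
  basis_of (boundary A P) L ->
  (<<(layer A P Q : seq V) ++ L>> = Q :&: outer A P)%VS.
Proof. by move=> sP sQ sPQ bL; rewrite span_cat (span_basis bL) layer_boundaryl. Qed.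

Lemma span_layer_basisr A P Q R : (P <= Q)%VS -> basis_of (boundary A Q) R ->
  (<<(layer A P Q : seq V) ++ R>> = Q :&: outer A P)%VS.
Proof. by move=> sPQ bR; rewrite span_cat (span_basis bR) layer_boundaryr. Qed.

Lemma boundary_subl A P Q : (P <= Q)%VS -> (boundary A P <= Q :&: outer A P)%VS.
Proof. by move=> sPQ; rewrite capvS. Qed.

Lemma boundary_subr A P Q : (P <= Q)%VS -> (boundary A Q <= Q :&: outer A P)%VS.
Proof. by move=> sPQ; rewrite capvS ?outerS. Qed.

Lemma layer_rooted A P Q L R : spanned A P -> spanned A Q -> (P <= Q)%VS ->
  basis_of (boundary A P) L -> basis_of (boundary A Q) R ->
  rooted_axiom (layer A P Q) L R.
Proof.
move=> sP sQ sPQ bL bR; apply/and4P; split.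
- exact: basis_free bL.
- exact: basis_free bR.
- apply/allP => x /(basis_mem bR) xR.
  by rewrite (span_layer_basisl sP sQ) // (subvP (boundary_subr A sPQ)).
- apply/allP => x /(basis_mem bL) xL.
  by rewrite (span_layer_basisr sPQ bR) (subvP (boundary_subl A sPQ)).
Qed.

Lemma layer_rspan A P Q L R (H : rooted V) :
  spanned A P -> spanned A Q -> (P <= Q)%VS ->
  basis_of (boundary A P) L -> basis_of (boundary A Q) R ->
  rbody H = layer A P Q -> rleft H = L -> rright H = R ->
  rspan H = (Q :&: outer A P)%VS.
Proof.
move=> sP sQ sPQ bL bR HB HL HR; rewrite /rspan HB HL HR catA span_cat.
rewrite (span_layer_basisl sP sQ) // (span_basis bR).
exact/addv_idPl/boundary_subr.
Qed.

(** On the boundary of [P], this picks the vector in the boundary of [Q] that contracting a linking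
    set [C] identifies with the given one. *)
Definition transfer A Q C := daddv_pi (outer A Q) <<C>>.

Lemma transfer_sub A P Q C v : linking A P Q C -> v \in boundary A P ->
  v - transfer A Q C v \in <<C>>%VS.
Proof.
move=> [_ _ QC _ eO] /memv_capP[_]; rewrite -eO => /(daddv_pi_add QC) ev.
by rewrite -{1}ev addrC addKr memv_pi.
Qed.

(** A vector of the boundary killed by [transfer] lies in both [P] and the span of [C], hence is 0;
    equal dimensions give surjectivity. *)
Lemma transfer_basis A P Q C L : linking A P Q C ->
  \dim (boundary A P) = \dim (boundary A Q) ->
  basis_of (boundary A P) L -> basis_of (boundary A Q) (map (transfer A Q C) L).
Proof.
move=> lk dPQ bL; have [sC PC QC eQ eO] := lk.
have ker0 : (boundary A P :&: lker (transfer A Q C) = 0)%VS.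
  apply/eqP; rewrite -subv0; apply/subvP => v /memv_capP[bv]; rewrite memv_ker => /eqP v0.
  rewrite -PC memv_cap; have := transfer_sub lk bv; rewrite v0 subr0 => ->; rewrite andbT.
  by case/memv_capP: bv.
have <- : (transfer A Q C @: boundary A P = boundary A Q)%VS.
  apply/eqP; rewrite eqEdim limg_dim_eq // dPQ leqnn andbT.
  apply/subvP => _ /memv_imgP[v bv ->]; rewrite memv_cap memv_pi andbT.
  have /subvP sPC : (P + <<C>> <= Q)%VS by rewrite eQ.
  apply: sPC; rewrite -[transfer _ _ _ _](subKr v) rpredB //.
    by apply: (subvP (addvSl _ _)); case/memv_capP: bv.
  by apply: (subvP (addvSr _ _)); apply: transfer_sub lk bv.
exact: limg_basis_of.
Qed.

Lemma lker_daddv_compl U : lker (daddv_pi U^C U) = U.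
Proof.
apply/vspaceP => v; rewrite memv_ker daddv_pi_eq0 //; first by rewrite capvC capv_compl.
by rewrite addvC addv_complf memvf.
Qed.

(** Contract [C]: a terminal and its transfer differ by a vector of the span of [C], and the left
    terminals stay independent because that span meets [P] trivially. *)
Lemma layer_linked A P Q C L (H : rooted V) : linking A P Q C ->
  basis_of (boundary A P) L ->
  rbody H = layer A P Q -> rleft H = L -> rright H = map (transfer A Q C) L ->
  linked H.
Proof.
move=> lk bL HB HL HR; have [sC PC QC eQ eO] := lk.
pose f : 'Hom(V, V) := daddv_pi <<C>>^C <<C>>.
have kf : lker f = <<C>>%VS by apply: lker_daddv_compl.
have fL : map f (map (transfer A Q C) L) = map f L.
  rewrite -map_comp; apply/eq_in_map => v /(basis_mem bL) vL /=.
  apply/esym/eqP; rewrite -subr_eq0 -linearB /= -memv_ker kf.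
  exact: transfer_sub vL.
have rax : rooted_axiom (seq_mset (map f (layer A P Q))) (map f L) (map f L).
  have fr : free (map f L).
    apply: (@basis_free _ _ (f @: boundary A P)); apply: limg_basis_of => //.
    apply/eqP; rewrite -subv0 -PC kf; apply: capvS => //; exact: capvSl.
  rewrite /rooted_axiom fr /= andbb; apply/allP => x xL.
  by apply: memv_span; rewrite mem_cat xL orbT.
exists V, (Rooted rax); split=> //; exists f; rewrite HB HL HR /= fL; split=> //; split=> //.
- by rewrite limg_span span_seq_mset.
(* The layer has no repetitions, so [C] must lose its own to be a submultiset. *)
- have uC : {subset undup C <= layer A P Q} by move=> x; rewrite mem_undup => /sC.
  exists (seq_mset (undup C)); first by apply: seq_mset_subset; rewrite ?undup_uniq.
  rewrite span_seq_mset (eq_span (mem_undup C)) kf; apply/capv_idPl.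
  by rewrite /rspan HB; apply: sub_span => x /sC xC; rewrite mem_cat xC.
- exact: msubset_refl.
Qed.

(** The two spans are [Q :&: outer A P] and [U :&: outer A Q], and they meet in the boundary of
    [Q]. *)
Lemma layer_product q A P Q U L X R (H H1 H2 : rooted V) :
  spanned A P -> spanned A Q -> spanned A U -> (P <= Q)%VS -> (Q <= U)%VS ->
  basis_of (boundary A P) L -> basis_of (boundary A Q) X -> basis_of (boundary A U) R ->
  size L = q -> size X = q -> size R = q ->
  rbody H = layer A P U -> rleft H = L -> rright H = R ->
  rbody H1 = layer A P Q -> rleft H1 = L -> rright H1 = X ->
  rbody H2 = layer A Q U -> rleft H2 = X -> rright H2 = R ->
  is_product q H H1 H2.
Proof.
move=> sP sQ sU sPQ sQU bL bX bR zL zX zR HB HL HR H1B H1L H1R H2B H2L H2R.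
rewrite /is_product HB HL HR H1B H1L H1R H2B H2L H2R zL zR leqnn.
have -> : (<<(layer A P Q : seq V) ++ L>> :&: <<(layer A Q U : seq V) ++ R>>)%VS = boundary A Q.
  rewrite (span_layer_basisl sP sQ) // (span_layer_basisr sQU bR).
  apply/eqP; rewrite eqEsubv [X in _ && X]subv_cap boundary_subr // boundary_subl // !andbT.
  by rewrite /boundary; apply: capvS; [apply: capvSl|apply: capvSr].
by split=> //; [exact: layerD | split=> //; rewrite -(span_basis bX) -zX dim_span].
Qed.

End Patches.

(** * Pruning and the number of points of a layer *)

Section Pruned.
Local Open Scope mset_scope.
Local Open Scope ring_scope.
Context {K : finFieldType} {V : vectType K} (R : realType).
Implicit Types (A : {mset V}) (P Q : {vspace V}) (C : seq V).

Lemma mrank_config A : mrank (config_matroid A) = \dim <<A>>.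
Proof.
rewrite /mrank /= /config_rank; congr (\dim _); apply: eq_span => x.
apply/fintype.imageP/idP => [[i _ ->]|/seq_tnthP[i ->]]; first exact: mem_tnth.
by exists i.
Qed.

Lemma mdensity_config A : mdensity R (config_matroid A) = density R A.
Proof. by rewrite /mdensity mrank_config. Qed.

(** Every position with vector in the span of [C] is contracted; the empty deletion gives the shape
    required by [matroid_minor]. *)
Let contraction A C : matroid 'I_(size A) :=
  delete (Defs.contract (config_matroid A) [set i | tnth (in_tuple A) i \in <<C>>%VS])
    finset.set0.

Lemma span_contracted A C : {subset C <= A} ->
  (<<subconfig [set i : 'I_(size A) | tnth (in_tuple A) i \in <<C>>%VS]>> = <<C>>)%VS.
Proof.
move=> sC; apply/eqP; rewrite eqEsubv; apply/andP; split; apply/span_subvP => x.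
  by case/fintype.imageP => i; rewrite inE => iC ->.
move=> Cx; have /seq_tnthP[i xi] := sC x Cx; apply: memv_span; rewrite xi.
by apply/fintype.imageP; exists i; rewrite // inE -xi memv_span.
Qed.

Lemma rank_contraction A C X : {subset C <= A} ->
  rank (contraction A C) X = (\dim (<<subconfig X>> + <<C>>) - \dim <<C>>)%N.
Proof.
move=> sC; rewrite /= finset.setD0 /contract_rank /= /config_rank.
by rewrite span_subconfigU span_contracted.
Qed.

Lemma mrank_contraction A C : {subset C <= A} ->
  mrank (contraction A C) = (\dim <<A>> - \dim <<C>>)%N.
Proof.
move=> sC; rewrite /mrank rank_contraction // -(span_contracted sC) -span_subconfigU.
rewrite /= finset.setD0 finset.setTD -finset.setUC finset.setUCr.
by have := mrank_config A; rewrite /mrank /= /config_rank => ->.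
Qed.

Lemma rank_contraction1 A C (i : 'I_(size A)) : {subset C <= A} ->
  rank (contraction A C) [set i] = (tnth (in_tuple A) i \notin <<C>>%VS).
Proof.
by move=> sC; rewrite rank_contraction // span_subconfig1 addvC dim_line_add addKn.
Qed.

Lemma rank_contraction2 A C (i j : 'I_(size A)) : {subset C <= A} ->
  rank (contraction A C) [set i; j] = ((tnth (in_tuple A) i \notin <<C>>%VS) +
    (tnth (in_tuple A) j \notin <<C>> + <[tnth (in_tuple A) i]>)%VS)%N.
Proof.
move=> sC; rewrite rank_contraction // span_subconfigU !span_subconfig1.
by rewrite addvC addvA !dim_line_add -addnA addKn.
Qed.

(* Contracting [C] identifies no two points outside the layer: on [P] and on
   the outer span of [Q] the map is injective, and a point outside [Q] cannot
   become parallel to one in [P], because the contracted vectors lie in [Q]. *)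
Lemma points_contraction A P Q C : linking A P Q C ->
  (points A <= points (layer A P Q) + num_points (contraction A C))%N.
Proof.
move=> [sCl PC QC eQ eO].
have sC : {subset C <= A} by move=> x /sCl; rewrite mem_layer => /and3P[].
have sCQ : (<<C>> <= Q)%VS by rewrite -eQ addvSr.
have sPQ : (P <= Q)%VS by rewrite -eQ addvSl.
have [s [sA nps <-]] := nonparallel_exists A.
pose inl := fun v => v \in layer A P Q.
rewrite -(count_predC inl) -!size_filter leq_add //.
  apply: nonparallel_points; last exact: nonparallel_filter.
  by move=> x; rewrite mem_filter => /andP[].
set s2 := seq.filter _ s; have [us2 s20 ss2] : nonparallel s2 by apply: nonparallel_filter.
have s2P x : x \in s2 -> x \in P \/ x \notin Q.
  rewrite mem_filter /= /inl mem_layer => /andP[nl /sA Ax].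
  by move: nl; rewrite Ax /= negb_and negbK orbC => /orP[]; [left|right].
have s2A x : x \in s2 -> x \in A by rewrite mem_filter => /andP[_ /sA].
have s2C x : x \in s2 -> x \notin <<C>>%VS.
  move=> s2x; case: (s2P x s2x) => [Px|]; last by apply: contra; apply/subvP.
  apply: contra (s20 x s2x) => Cx; rewrite -memv0 -PC memv_cap Px; exact: Cx.
have s2CC x y : x \in s2 -> y \in s2 -> x != y -> x \notin (<<C>> + <[y]>)%VS.
  move=> s2x s2y nxy; apply: contra (ss2 x y s2x s2y nxy).
  case/memv_addP => c Cc [_ /vlineP[k ->] ex].
  have cP (U : {vspace V}) : (U :&: <<C>> = 0)%VS -> x \in U -> y \in U -> x \in <[y]>%VS.
    move=> UC Ux Uy; have : c \in (U :&: <<C>>)%VS.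
      rewrite memv_cap Cc andbT; have -> : c = x - k *: y by rewrite ex addrK.
      by rewrite rpredB // memvZ.
    by rewrite UC memv0 => /eqP c0; rewrite ex c0 add0r memvZ ?memv_line.
  have Qc : c \in Q by apply: (subvP sCQ).
  case: (s2P x s2x) (s2P y s2y) => [Px|nQx] [Py|nQy].
  - exact: cP PC Px Py.
  - have Qky : k *: y \in Q.
      have -> : k *: y = x - c by rewrite ex addrC addKr.
      by rewrite rpredB // (subvP sPQ).
    have [k0|k0] := eqVneq k 0.
      by have := s2C x s2x; rewrite ex k0 scale0r addr0 Cc.
    by rewrite -[y]scale1r -(mulVf k0) -scalerA memvZ in nQy.
  - by rewrite ex rpredD // ?memvZ ?(subvP sPQ) in nQx.
  - by apply: cP QC _ _; apply: mem_outer => //; apply: s2A.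
pose S := [set i : 'I_(size A) | (tnth (in_tuple A) i \in s2) &&
   (index (tnth (in_tuple A) i) A == i)]%SET.
apply: (@leq_trans #|S|).
  rewrite -(size_image (tnth (in_tuple A))); apply: uniq_leq_size => // x s2x.
  have Ax : (index x A < size A)%N by rewrite index_mem s2A.
  have ex : tnth (in_tuple A) (Ordinal Ax) = x.
    by rewrite (tnth_nth 0) /= nth_index ?s2A.
  by apply/fintype.imageP; exists (Ordinal Ax); rewrite ?inE ?ex ?s2x ?eqxx.
apply: leq_card_num_points.
- apply/fintype.subsetP => i; rewrite inE => /andP[si _]; rewrite /= !inE.
  by rewrite andbT s2C.
- by move=> i; rewrite inE => /andP[si _]; rewrite rank_contraction1 // s2C.
- move=> i j; rewrite !inE => /andP[si /eqP ii] /andP[sj /eqP jj] nij.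
  rewrite rank_contraction2 // s2C // s2CC //; apply: contra_neq nij => eij.
  by apply: val_inj; rewrite /= -ii -jj eij.
Qed.

(** Contracting [C] lowers the rank by [\dim Q - \dim P]. Pruning bounds the number of lost points
    from below, and [points_contraction] bounds it from above by the points of the layer. *)
Lemma pruned_layer (delta : R) k A P Q C :
  pruned_matroid delta k (config_matroid A) -> linking A P Q C ->
  (\dim Q - \dim P <= k)%N ->
  (density R A - delta) * (\dim Q - \dim P)%:R <= (points (layer A P Q))%:R.
Proof.
move=> pA lk lek; have [sCl PC QC eQ eO] := lk.
have sC : {subset C <= A} by move=> x /sCl; rewrite mem_layer => /and3P[].
have dCA : (\dim <<C>> <= \dim <<A>>)%N by apply/dimvS/sub_span.
have dQ := dim_linking lk; have rN := mrank_contraction sC.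
have mC : matroid_minor (config_matroid A) (contraction A C).
  exists [set i : 'I_(size A) | tnth (in_tuple A) i \in <<C>>%VS]%SET, finset.set0.
  by rewrite finset.subsetT finset.sub0set finset.disjoints_subset finset.setC0 finset.subsetT.
have leN : (mrank (config_matroid A) <= mrank (contraction A C) + k)%N.
  by rewrite rN mrank_config; lia.
have := pA _ mC leN.
rewrite mdensity_config rN mrank_config -natrB ?leq_subr // subKn // => h.
have -> : (\dim Q - \dim P)%N = \dim <<C>> by rewrite dQ addKn.
apply: le_trans h _; rewrite lerBlDr -natrD ler_nat.
exact: points_contraction.
Qed.

End Pruned.

(** * Isomorphism types *)

Section Isomorphism.
Import VectorInternalTheory.
Local Open Scope mset_scope.
Local Open Scope ring_scope.
Context {K : finFieldType}.

(** Patches of bounded dimension from different ambient spaces are compared inside one finite space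
    of row vectors. *)
Lemma coordinates_exist (V : vectType K) (U : {vspace V}) D : (\dim U <= D)%N ->
  exists (f : 'Hom(V, 'rV[K]_D)) (g : 'Hom('rV[K]_D, V)), {in U, cancel f g}.
Proof.
(* The rows of [B] are a basis of [U] padded with the default 0, so vectors of [U] lie in its row
   space. *)
move=> leUD; pose B := \matrix_(i < D) v2r ((vbasis U)`_i).
exists (linfun (mulmxr (pinvmx B) \o v2r)), (linfun (r2v \o mulmxr B)) => v Uv.
rewrite !lfunE /= mulmxKpV ?v2rK // (coord_vbasis Uv) linear_sum.
apply: summx_sub => i _; rewrite linearZ /=; apply: scalemx_sub.
have -> : v2r (vbasis U)`_i = row (widen_ord leUD i) B by rewrite rowK.
exact: row_sub.
Qed.

(** The isomorphism is [g2 \o f1], injective because [f1] and [f2] map the two spans onto the same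
    subspace. *)
Lemma rooted_iso_coordinates (V1 V2 W : vectType K) (H1 : rooted V1) (H2 : rooted V2)
    (f1 : 'Hom(V1, W)) (g1 : 'Hom(W, V1)) (f2 : 'Hom(V2, W)) (g2 : 'Hom(W, V2)) :
  {in rspan H1, cancel f1 g1} -> {in rspan H2, cancel f2 g2} ->
  uniq (rbody H1) -> uniq (rbody H2) ->
  map f1 (rbody H1) =i map f2 (rbody H2) ->
  map f1 (rleft H1) = map f2 (rleft H2) ->
  map f1 (rright H1) = map f2 (rright H2) -> rooted_iso H1 H2.
Proof.
move=> K1 K2 u1 u2 eB eL eR; pose h : 'Hom(V1, V2) := (g2 \o f1)%VF.
have inS (V : vectType K) (H : rooted V) : forall v,
    [|| v \in rbody H, v \in rleft H | v \in rright H] -> v \in rspan H.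
  by move=> v vH; apply: memv_span; rewrite !mem_cat.
have mapK (s : seq V2) : {subset s <= rspan H2} -> map g2 (map f2 s) = s.
  move=> sH; rewrite -map_comp -[RHS]map_id; apply/eq_in_map => v /sH vH /=.
  exact: K2.
have maph s : map h s = map g2 (map f1 s).
  by rewrite -map_comp; apply: eq_map => v /=; rewrite comp_lfunE.
have B2 : {subset rbody H2 <= rspan H2} by move=> v vB; apply: inS; rewrite vB.
have L2 : {subset rleft H2 <= rspan H2} by move=> v vB; apply: inS; rewrite vB orbT.
have R2 : {subset rright H2 <= rspan H2} by move=> v vB; apply: inS; rewrite vB !orbT.
have hB : map h (rbody H1) =i rbody H2.
  by move=> v; rewrite maph (eq_mem_map g2 eB) mapK.
have hL : map h (rleft H1) = rleft H2 by rewrite maph eL mapK.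
have hR : map h (rright H1) = rright H2 by rewrite maph eR mapK.
have himg : (h @: rspan H1 = rspan H2)%VS.
  rewrite limg_span; apply: eq_span => v.
  by rewrite !map_cat !mem_cat hB hL hR.
have f12 : (f1 @: rspan H1 = f2 @: rspan H2)%VS.
  by rewrite !limg_span; apply: eq_span => v; rewrite !map_cat !mem_cat eB eL eR.
have hker : (lker h :&: rspan H1 = 0)%VS.
  apply/eqP; rewrite -subv0; apply/subvP => v /memv_capP[]; rewrite memv_ker comp_lfunE.
  move=> /eqP hv vH; have : f1 v \in (f2 @: rspan H2)%VS by rewrite -f12 memv_img.
  case/memv_imgP => y yH ev; rewrite memv0 -(K1 v vH); move: hv.
  by rewrite ev (K2 y yH) => ->; rewrite !linear0.
exists h; split=> //; rewrite -[RHS]seq_mset_id; apply/eq_seq_msetP/uniq_perm => //.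
rewrite map_inj_in_uniq // => x y xB yB exy; apply/eqP; rewrite -subr_eq0 -memv0 -hker.
by rewrite memv_cap memv_ker linearB /= exy subrr eqxx rpredB //; apply: inS; rewrite ?xB ?yB.
Qed.

(** The code lies in a finite type, as the colouring along the ultrafilter requires. *)
Definition rooted_code (V : vectType K) q D (f : 'Hom(V, 'rV[K]_D)) (H : rooted V) :
    {set 'rV[K]_D} * {ffun 'I_q -> 'rV[K]_D} * {ffun 'I_q -> 'rV[K]_D} :=
  ([set x | x \in map f (rbody H)]%SET, [ffun i : 'I_q => f (rleft H)`_i],
   [ffun i : 'I_q => f (rright H)`_i]).

Lemma rooted_code_iso (V1 V2 : vectType K) q D (H1 : rooted V1) (H2 : rooted V2)
    (f1 : 'Hom(V1, 'rV[K]_D)) (g1 : 'Hom('rV[K]_D, V1))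
    (f2 : 'Hom(V2, 'rV[K]_D)) (g2 : 'Hom('rV[K]_D, V2)) :
  {in rspan H1, cancel f1 g1} -> {in rspan H2, cancel f2 g2} ->
  uniq (rbody H1) -> uniq (rbody H2) -> is_patch q H1 -> is_patch q H2 ->
  rooted_code q f1 H1 = rooted_code q f2 H2 -> rooted_iso H1 H2.
Proof.
move=> K1 K2 u1 u2 [zL1 zR1] [zL2 zR2] [/finset.setP eB /ffunP eL /ffunP eR].
have emap s1 s2 : size s1 = q -> size s2 = q ->
    (forall i : 'I_q, f1 s1`_i = f2 s2`_i) -> map f1 s1 = map f2 s2.
  move=> z1 z2 es; apply: (@eq_from_nth _ 0); rewrite ?size_map ?z1 ?z2 // => i lti.
  by rewrite !(nth_map 0) ?z1 ?z2 //; apply: (es (Ordinal lti)).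
apply: (rooted_iso_coordinates K1 K2) => //.
- by move=> x; have := eB x; rewrite !inE.
- by apply: emap => // i; have := eL i; rewrite !ffunE.
- by apply: emap => // i; have := eR i; rewrite !ffunE.
Qed.

End Isomorphism.

(** * Chains of separations along an ultrafilter *)

Section UltrafilterChains.
Local Open Scope mset_scope.
Local Open Scope ring_scope.
Context {K : finFieldType} (A : nat -> config K) (U : set_system nat).
Hypothesis ultraU : UltraFilter U.

(** If every colour were avoided for most [n], then for most [n] all of the finitely many would
    be. *)
Lemma ultra_finite_color (T : finType) (c : nat -> T) :
  exists t, \forall n \near U, c n = t.
Proof.
apply: contrapT => /forallNP noc.
have : \forall n \near U, forall t, c n <> t.
  apply: filter_forall => t.
  by have [/noc|] := in_ultra_setVsetC [set n | c n = t]%classic ultraU.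
by move=> /filter_ex[n /(_ (c n))].
Qed.

Lemma near_ultraN (P : nat -> Prop) :
  ~ (\forall n \near U, P n) -> \forall n \near U, ~ P n.
Proof. by move=> nP; have [|] := in_ultra_setVsetC [set n | P n]%classic ultraU. Qed.

Lemma near_forall_ltn (P : nat -> nat -> Prop) m :
  (forall i, \forall n \near U, P n i) ->
  \forall n \near U, forall i, (i < m)%N -> P n i.
Proof.
move=> nP; elim: m => [|m IHm]; first by apply: filterE.
apply: filterS2 IHm (nP m) => n IHn Pm i.
by rewrite ltnS leq_eqVlt => /orP[/eqP->|/IHn].
Qed.

Let space n := cspace (A n).
Implicit Types (P : forall n, nat -> {vspace space n}) (k : nat -> nat).

(** Each [j] has its own set of good [n]; only the bound [k j] has to be uniform in [n]. *)
Definition separation_chain q k P := forall j, \forall n \near U,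
  [/\ spanned (A n) (P n j),
      (\dim (P n j) + \dim (outer (A n) (P n j)) <= \dim <<A n>> + q)%N,
      (\dim (P n j) <= k j)%N, (P n j <= P n j.+1)%VS
    & (\dim (P n j) < \dim (P n j.+1))%N].

(** By [dim_boundary], the inequality says that [X] has order at least [q]. *)
Definition unbreakable q P j := \forall n \near U, forall X : {vspace space n},
  spanned (A n) X -> (P n j <= X)%VS -> (X <= P n j.+1)%VS ->
  (\dim <<A n>> + q <= \dim X + \dim (outer (A n) X))%N.

Lemma separation_chain_mono q k P i j : separation_chain q k P -> (i <= j)%N ->
  \forall n \near U, (P n i <= P n j)%VS.
Proof.
move=> cP /subnKC <-; elim: (j - i)%N => [|d IHd].
  by apply: filterE => n; rewrite addn0.
rewrite addnS; apply: filterS2 IHd (cP (i + d)%N) => n sd [_ _ _ sS _].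
exact: subv_trans sd sS.
Qed.

(* Infinitely many breakable steps yield a chain of smaller order. *)
Lemma separation_chain_unbreakable q k P : separation_chain q k P ->
  exists q' k' P', separation_chain q' k' P' /\ forall j, unbreakable q' P' j.
Proof.
elim: q k P => [|q IHq] k P cP.
  (* No flat has negative order. *)
  exists 0%N, k, P; split=> // j; apply: filterE => n X sX _ _.
  by rewrite addn0 -(dim_boundary sX) leq_addr.
have [[N unb]|] := pselect (exists N, forall i, (N <= i)%N -> unbreakable q.+1 P i).
  exists q.+1, (fun j => k (N + j)%N), (fun n j => P n (N + j)%N); split => j.
    by rewrite !addnS; apply: cP.
  by have := unb (N + j)%N (leq_addr _ _); rewrite /unbreakable addnS.
move=> /forallNP brk.
have {}brk N : exists i, (N <= i)%N /\ ~ unbreakable q.+1 P i.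
  by have := brk N => /existsNP[i /not_implyP[leNi nb]]; exists i.
pose h N := projT1 (cid (brk N)).
have hP N : (N <= h N)%N /\ ~ unbreakable q.+1 P (h N) by apply: (projT2 (cid (brk N))).
(* Chosen steps are at least two apart, so a whole step of [P] separates consecutive crossing flats
   and dimensions still strictly grow. *)
pose idx := fix idx s := if s is s'.+1 then h (idx s').+2 else h 0%N.
have idxS s : ((idx s).+2 <= idx s.+1)%N by have [] := hP (idx s).+2.
have idxB s : ~ unbreakable q.+1 P (idx s) by case: s => [|s]; [case: (hP 0%N)|case: (hP (idx s).+2)].
pose brkP n s (X : {vspace space n}) := [/\ spanned (A n) X, (P n (idx s) <= X)%VS,
  (X <= P n (idx s).+1)%VS & (\dim X + \dim (outer (A n) X) <= \dim <<A n>> + q)%N].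
have exX n s : exists X, (exists Y, brkP n s Y) -> brkP n s X.
  by have [[Y YP]|nY] := pselect (exists Y, brkP n s Y); [exists Y|exists 0%VS].
pose X n s := projT1 (cid (exX n s)).
(* As [U] is an ultrafilter, a step that is not unbreakable is crossed for most [n]. *)
have XP s : \forall n \near U, brkP n s (X n s).
  apply: filterS (near_ultraN (idxB s)) => n nub.
  apply: (projT2 (cid (exX n s))).
  move: nub => /existsNP[Y /not_implyP[sY /not_implyP[PY /not_implyP[YP /negP]]]].
  by rewrite -ltnNge addnS ltnS => oY; exists Y.
apply: (IHq (fun s => k (idx s).+1) X) => s.
have := separation_chain_mono cP (idxS s).
apply: filterS3 (filterI (XP s) (XP s.+1)) (filterI (cP (idx s)) (cP (idx s).+1)) => n.
move=> [[sX PX XP1 oX] [_ PX' _ _]] [_ [_ _ lek sS ltS]] P2.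
split=> //.
- exact: leq_trans (dimvS XP1) lek.
- exact: subv_trans XP1 (subv_trans sS (subv_trans P2 PX')).
- apply: leq_ltn_trans (dimvS XP1) (leq_trans ltS (dimvS _)).
  exact: subv_trans P2 PX'.
Qed.

End UltrafilterChains.

(** * The initial chain from bounded branch-width *)

Lemma spanned_span (K : finFieldType) (V : vectType K) (A : {mset V}%mset) (s : seq V) :
  {subset s <= A} -> spanned A <<(s : seq V)>>%VS.
Proof.
move=> sA; apply/eqP; rewrite eqEsubv; apply/andP; split; apply/span_subvP => x.
  by rewrite mem_filter => /andP[].
by move=> sx; apply: memv_span; rewrite mem_filter memv_span // sA.
Qed.

Section InitialChain.
Local Open Scope mset_scope.
Local Open Scope ring_scope.
Context {K : finFieldType}.

(** The flats are the spans of the displayed sets. A vector outside such a span is outside the set,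
    so passing to the span does not raise the order. *)
Lemma branch_width_separations (V : vectType K) (A : {mset V}) w :
  branch_width_at_most (config_matroid A) w ->
  exists P : nat -> {vspace V}, forall j, (3 ^ j.+2 <= \dim <<A>>)%N ->
    [/\ spanned A (P j), (\dim (P j) + \dim (outer A (P j)) <= \dim <<A>> + `|w|)%N,
        (3 ^ j <= \dim (P j) <= 2 * 3 ^ j)%N & (P j <= P j.+1)%VS].
Proof.
(* This [m] gives [2 * 3 ^ m < 3 ^ m.+1 <= \dim <<A>>] once the dimension is at least 3; smaller
   dimensions satisfy the claim vacuously. *)
move=> bw; pose M := config_matroid A; pose m := (trunc_log 3 (\dim <<A>>)).-1.
have [le3|lt3] := leqP 3 (\dim <<A>>); last first.
  exists (fun=> 0%VS) => j le; suff : (3 <= 3 ^ j.+2)%N by lia.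
  by rewrite (leq_pexp2l (n2 := j.+2) (n1 := 1)).
have log_gt0 : (1 <= trunc_log 3 (\dim <<A>>))%N by apply: trunc_log_max.
have [|X XP] := @branch_width_chain _ M w m bw.
  rewrite mrank_config; have : (3 ^ m.+1 <= \dim <<A>>)%N.
    by rewrite prednK // trunc_logP //; apply: leq_trans le3.
  rewrite expnS; have : (0 < 3 ^ m)%N by rewrite expn_gt0.
  by lia.
exists (fun j => <<subconfig (X j)>>%VS) => j lej.
have ltjm : (j < m)%N.
  by have : (j.+2 <= trunc_log 3 (\dim <<A>>))%N by [apply: trunc_log_max]; rewrite /m; lia.
have [sX rX cX nX] := XP j (ltnW ltjm); split=> //.
- by apply: spanned_span => x /fintype.imageP[i _ ->]; apply: mem_tnth.
- have : (\dim (outer A <<subconfig (X j)>>%VS) <= rank M (ground M :\: X j))%N.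
    apply: dimvS; apply: sub_span => x; rewrite mem_filter => /andP[nx /seq_tnthP[i xi]].
    apply/fintype.imageP; exists i => //; rewrite !inE andbT.
    by apply: contra nx => Xi; apply: memv_span; apply/fintype.imageP; exists i.
  have := mrank_config A; move: cX; rewrite /connectivity /M /=; rewrite /config_rank; lia.
- by apply: sub_span; apply: subconfigS; apply: nX.
Qed.

Lemma dim_infty (A : nat -> config K) : 
  (points (A i) @[i --> \oo] --> \oo)%classic ->
  forall b, (\forall n \near \oo, (b <= \dim <<A n>>)%N)%classic.
Proof.
move=> /cvgnyPge pA b; have := pA (#|K| ^ b)%N; apply: filterS => n leb.
have := leq_trans leb (leq_points (A n)).
by rewrite leq_exp2l // card_finNzRing_gt1.
Qed.

Lemma separation_chain_exists (A : nat -> config K) (U : set_system nat) w :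
  UltraFilter U -> (\oo `<=` U)%classic ->
  (forall i, (1 <= i)%N -> branch_width_at_most (config_matroid (A i)) w) ->
  (points (A i) @[i --> \oo] --> \oo)%classic ->
  exists P : forall n, nat -> {vspace cspace (A n)}, separation_chain U `|w|%N (fun j => 2 * 3 ^ j)%N P.
Proof.
move=> ultraU sU bw pA.
have exP n : exists P : nat -> {vspace cspace (A n)}, (1 <= n)%N ->
    forall j, (3 ^ j.+2 <= \dim <<A n>>)%N ->
    [/\ spanned (A n) (P j),
        (\dim (P j) + \dim (outer (A n) (P j)) <= \dim <<A n>> + `|w|)%N,
        (3 ^ j <= \dim (P j) <= 2 * 3 ^ j)%N & (P j <= P j.+1)%VS].
  case: n => [|n]; first by exists (fun=> 0%VS).
  by have [P PP] := branch_width_separations (bw n.+1 isT); exists P.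
exists (fun n => projT1 (cid (exP n))) => j; apply: sU.
(* The exponent [j.+3] makes member [j.+1] available too; then [2 * 3 ^ j < 3 ^ j.+1] gives the
   strict growth. *)
apply: filterS2 (dim_infty pA (3 ^ j.+3)%N) (nbhs_infty_ge 1) => n dn n1.
have PP := projT2 (cid (exP n)) n1.
have dn' : (3 ^ j.+2 <= \dim <<A n>>)%N by apply: leq_trans dn; rewrite leq_pexp2l.
have [sP oP /andP[_ leP] PS] := PP j dn'; have [_ _ /andP[lePS _] _] := PP j.+1 dn.
split=> //; apply: leq_ltn_trans leP (leq_trans _ lePS).
by rewrite expnS ltn_pmul2r ?expn_gt0.
Qed.

End InitialChain.

(** * Linked chains *)

Section PatchSequence.
Local Open Scope mset_scope.
Local Open Scope ring_scope.
Context {K : finFieldType} (A : nat -> config K).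
Let space n := cspace (A n).
Context (q : nat) (k : nat -> nat) (P : forall n, nat -> {vspace space n}).
Arguments P : clear implicits.

Let linkable n j := exists C, linking (A n) (P n j) (P n j.+1) C.

Lemma link_exists n j : exists C, linkable n j -> linking (A n) (P n j) (P n j.+1) C.
Proof.
by have [[C CP]|nC] := pselect (linkable n j); [exists C|exists [::]].
Qed.

Definition link n j : seq (space n) := projT1 (cid (link_exists n j)).

(** One basis of the lowest boundary is carried up by the links, so consecutive patches share
    terminals and each is linked in the given order. *)
Fixpoint terminals n j : seq (space n) :=
  if j is i.+1 then
    map (transfer (A n) (P n j) (link n i)) (terminals n i)
  else vbasis (boundary (A n) (P n 0)).

Definition segment n i j : rooted (space n) :=
  mk_rooted (layer (A n) (P n i) (P n j)) (terminals n i) (terminals n j).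

Definition linked_step n j :=
  [/\ spanned (A n) (P n j), (P n j <= P n j.+1)%VS,
      \dim (boundary (A n) (P n j)) = q,
      (\dim (P n j) < \dim (P n j.+1))%N /\ (\dim (P n j.+1) <= k j.+1)%N
    & linkable n j].

(** Unbreakability applied to the ends of a step, which are flats themselves, turns the upper bound
    on their order into equality. *)
Lemma near_linked_step (U : set_system nat) j : UltraFilter U ->
  separation_chain U q k P -> (forall i, unbreakable U q P i) ->
  \forall n \near U, linked_step n j.
Proof.
move=> ultraU cP uP.
apply: filterS3 (filterI (cP j) (cP j.+1)) (uP j) (uP j.+1) => n.
move=> [[sP oP lek sPS ltS] [sP' oP' lek' sPS' ltS']] u0 u1.
have d0 : (\dim (P n j) + \dim (outer (A n) (P n j)) = \dim <<A n>> + q)%N.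
  by apply/eqP; rewrite eqn_leq oP u0.
have d1 : (\dim (P n j.+1) + \dim (outer (A n) (P n j.+1)) = \dim <<A n>> + q)%N.
  by apply/eqP; rewrite eqn_leq oP' u1.
split=> //; first by apply/eqP; rewrite -(eqn_add2l (\dim <<A n>>)) (dim_boundary sP) d0.
exact: linking_exists d0 d1 u0.
Qed.

Section Steps.
Variables (n m : nat).
Hypothesis steps : forall i, (i <= m)%N -> linked_step n i.

Lemma step_spanned i : (i <= m)%N -> spanned (A n) (P n i).
Proof. by case/steps. Qed.

Lemma step_subv i j : (i <= j <= m)%N -> (P n i <= P n j)%VS.
Proof.
case/andP => /subnKC <-; elim: (j - i)%N => [|d IHd] ltm; first by rewrite addn0.
rewrite addnS; apply: subv_trans (IHd _) _; first by move: ltm; lia.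
by have [|_ ? _ _ _] := @steps (i + d)%N; first by move: ltm; lia.
Qed.

Lemma step_linking i : (i < m)%N -> linking (A n) (P n i) (P n i.+1) (link n i).
Proof.
move=> ltim; have [_ _ _ _ li] := steps (ltnW ltim).
exact: (projT2 (cid (link_exists n i))) li.
Qed.

Lemma terminals_basis i : (i <= m)%N -> basis_of (boundary (A n) (P n i)) (terminals n i).
Proof.
elim: i => [|i IHi] lei /=; first exact: vbasisP.
apply: transfer_basis (step_linking lei) _ (IHi (ltnW lei)).
by have [_ _ -> _ _] := steps lei; have [_ _ -> _ _] := steps (ltnW lei).
Qed.

Lemma size_terminals i : (i <= m)%N -> size (terminals n i) = q.
Proof.
move=> lei; have bt := terminals_basis lei; have [_ _ <- _ _] := steps lei.
by rewrite -(size_basis (X := in_tuple (terminals n i)) bt).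
Qed.

Lemma segmentE i j : (i <= j <= m)%N ->
  [/\ rbody (segment n i j) = layer (A n) (P n i) (P n j),
      rleft (segment n i j) = terminals n i
    & rright (segment n i j) = terminals n j].
Proof.
move=> /[dup] sij /andP[leij lejm]; have leim := leq_trans leij lejm.
apply: mk_rootedE; apply: layer_rooted; rewrite ?step_subv ?terminals_basis //;
  exact: step_spanned.
Qed.

Lemma segment_patch i j : (i <= j <= m)%N -> is_patch q (segment n i j).
Proof.
move=> /[dup] /segmentE[_ eL eR] /andP[leij lejm].
by rewrite /is_patch eL eR !size_terminals // (leq_trans leij).
Qed.

Lemma segment_rspan i j : (i <= j <= m)%N ->
  \dim (rspan (segment n i j)) = (\dim (P n j) - \dim (P n i) + q)%N.
Proof.
move=> /[dup] sij /andP[leij lejm]; have [eB eL eR] := segmentE sij.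
have leim := leq_trans leij lejm; have sP := step_subv sij.
have [si sj] := (step_spanned leim, step_spanned lejm).
rewrite (layer_rspan si sj sP (terminals_basis leim) (terminals_basis lejm) eB eL eR).
by rewrite dim_layer_span //; have [_ _ -> _ _] := steps leim.
Qed.

(** Factors are numbered from 1, so factor [j] runs from member [j.-1] to member [j]; each new one
    is attached by [layer_product]. *)
Lemma segment_product i : (i < m)%N ->
  iterated_product q [seq segment n j.-1 j | j <- index_iota 1 i.+2] (segment n 0 i.+1).
Proof.
elim: i => [|i IHi] ltim; first by rewrite /index_iota /=; apply: iterated_product1.
have -> : index_iota 1 i.+3 = rcons (index_iota 1 i.+2) i.+2.
  by rewrite /index_iota !subn1 -cats1 -(iotaD 1 i.+1 1) addn1.
rewrite map_rcons; apply: iterated_productS (IHi (ltnW ltim)) _ => /=.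
have [B1 L1 R1] := @segmentE 0 i.+1 (ltnW ltim).
have s2 : (i.+1 <= i.+2 <= m)%N by rewrite leqnSn.
have [B2 L2 R2] := segmentE s2.
have [B L E] := @segmentE 0 i.+2 ltim.
apply: layer_product B L E B1 L1 R1 B2 L2 R2;
  rewrite ?size_terminals ?terminals_basis ?step_subv ?leqnSn //; try exact: ltnW;
  apply: step_spanned => //; exact: ltnW.
Qed.

End Steps.

End PatchSequence.

(** * Choice of the patches *)

Local Open Scope classical_set_scope.
Local Open Scope ring_scope.

Theorem theorem5p1 (R : realType) (K : finFieldType) (w : int)
    (F : config K -> Prop) (Delta : R) (A : nat -> config K) :
  minor_closed F ->
  limiting_density R F = Delta%:E ->
  (forall i, (1 <= i)%N -> F (A i)) ->
  pruned_sequence R A ->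
  (forall i, (1 <= i)%N -> branch_width_at_most (config_matroid (A i)) w) ->
  density R (A i) @[i --> \oo] --> Delta ->
  points (A i) @[i --> \oo] --> \oo ->
  exists (q : nat) (V : nat -> vectType K) (H : forall j, rooted (V j)),
    forall j, (1 <= j)%N ->
      [/\ is_patch q (H j), nontrivial (H j) & linked (H j)] /\
      [/\ forall v, v \in rbody (H j) -> v \notin <<rleft (H j)>>%VS,
          (points (rbody (H j)))%:R >= Delta * ((\dim (rspan (H j)))%:R - q%:R)
        & exists (W : vectType K) (G : rooted W),
            products q H 1 j G /\ F (Config (rbody G))].
Proof.
move=> Fmin _ FA prA bwA dA pA.
have [U [ultraU sU]] := @ultraFilterLemma nat \oo _.
have [P0 cP0] := separation_chain_exists ultraU sU bwA pA.
have [q [k [P [cP uP]]]] := separation_chain_unbreakable ultraU cP0.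
pose patch n j := segment P n j j.+1.
pose D j := (k j.+1 + q)%N.
have exfg n j : exists fg : 'Hom(cspace (A n), 'rV[K]_(D j)) *
    'Hom('rV[K]_(D j), cspace (A n)),
    (\dim (rspan (patch n j)) <= D j)%N -> {in rspan (patch n j), cancel fg.1 fg.2}.
  have [/coordinates_exist[f [g fg]]|_] := leqP (\dim (rspan (patch n j))) (D j).
    by exists (f, g).
  by exists (0, 0).
pose fg n j := projT1 (cid (exfg n j)).
(* Besides the isomorphism type, the colour records the number of points and the rank of the layer.
   [inord] is faithful for good [n], by [le_points] and [le_dimP]. *)
pose color j n : _ * 'I_(#|K| ^ D j).+1 * 'I_(k j.+1).+1 :=
  (rooted_code q (fg n j).1 (patch n j), inord (points (rbody (patch n j))),
   inord (\dim (P n j.+1) - \dim (P n j))).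
have limc j := ultra_finite_color ultraU (color j).
pose c j := projT1 (cid (limc j)).
(* Patch [j] ends at member [j.+1], so the steps up to [j.+1] are required. *)
pose good n j := [/\ (1 <= n)%N, forall i, (i < j.+2)%N -> linked_step q k P n i
  & color j n = c j].
have near_good j : \forall n \near U, good n j.
  have n1 : \forall n \near U, (1 <= n)%N by apply: sU; apply: nbhs_infty_ge.
  have ns := near_forall_ltn ultraU j.+2 (fun i => near_linked_step i ultraU cP uP).
  by apply: filterS3 n1 ns (projT2 (cid (limc j))) => n; split.
have exN j : exists n, good n j by exact: filter_ex (near_good j).
pose N j := projT1 (cid (exN j)).
have goodN j : good (N j) j := projT2 (cid (exN j)).
have jj j : (j <= j.+1 <= j.+1)%N by rewrite leqnSn /=.
have le_dimP n j : good n j -> (\dim (P n j.+1) - \dim (P n j) <= k j.+1)%N.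
  by move=> [_ /(_ j (leqnSn _))[_ _ _ [_ lek] _] _]; apply: leq_trans (leq_subr _ _) lek.
have le_rspan n j : good n j -> (\dim (rspan (patch n j)) <= D j)%N.
  move=> gnj; have [_ st _] := gnj.
  by rewrite (segment_rspan st (jj j)) leq_add2r le_dimP.
have le_points n j : good n j -> (points (rbody (patch n j)) <= #|K| ^ D j)%N.
  move=> gnj; apply: leq_trans (leq_points _) _; apply: leq_pexp2l.
    exact: ltnW (card_finNzRing_gt1 K).
  apply: leq_trans (le_rspan n j gnj); apply: dimvS; apply: sub_span => x xB.
  by rewrite mem_cat xB.
have fgK n j : good n j -> {in rspan (patch n j), cancel (fg n j).1 (fg n j).2}.
  by move=> /le_rspan; apply: (projT2 (cid (exfg n j))).
have good_iso n1 n2 j : good n1 j -> good n2 j -> rooted_iso (patch n1 j) (patch n2 j).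
  move=> g1 g2; have [_ st1 c1] := g1; have [_ st2 c2] := g2.
  move: c1; rewrite -c2 => -[eB eL eR _ _].
  have [B1 _ _] := segmentE st1 (jj j); have [B2 _ _] := segmentE st2 (jj j).
  apply: (rooted_code_iso (q := q) (fgK _ _ g1) (fgK _ _ g2)).
  - by rewrite B1 layer_uniq.
  - by rewrite B2 layer_uniq.
  - exact (segment_patch st1 (jj j)).
  - exact (segment_patch st2 (jj j)).
  - by rewrite /rooted_code eB eL eR.
have good_points n1 n2 j : good n1 j -> good n2 j ->
    points (rbody (patch n1 j)) = points (rbody (patch n2 j)).
  move=> g1 g2; have [_ _ c1] := g1; have [_ _ c2] := g2.
  move: c1; rewrite -c2 => -[_ _ _ /(congr1 val) /= + _].
  by rewrite !inordK ?ltnS ?le_points.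
have good_dim n1 n2 j : good n1 j -> good n2 j ->
    (\dim (P n1 j.+1) - \dim (P n1 j) = \dim (P n2 j.+1) - \dim (P n2 j))%N.
  move=> g1 g2; have [_ _ c1] := g1; have [_ _ c2] := g2.
  move: c1; rewrite -c2 => -[_ _ _ _ /(congr1 val) /=].
  by rewrite !inordK ?ltnS ?le_dimP.
(* The sequence starts at 1: [H_j] is patch [j.-1], taken from a good index [N j.-1]. *)
exists q, (fun j => cspace (A (N j.-1))), (fun j => patch (N j.-1) j.-1) => -[//|j] _ /=.
have gN := goodN j; have [_ st _] := gN.
have [B L E] := segmentE st (jj j).
have lk := step_linking st (ltnSn j).
have bL := terminals_basis st (leqnSn j).
split; split.
- exact (segment_patch st (jj j)).
- rewrite /nontrivial L (span_basis bL) (segment_rspan st (jj j)).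
  have [_ _ -> [ltP _] _] := st j (leqnSn _); lia.
- exact: layer_linked lk bL B L E.
- move=> v; rewrite B L (span_basis bL) mem_layer => /and3P[_ _].
  by apply: contra => /memv_capP[].
- rewrite (segment_rspan st (jj j)) natrD addrK.
  set t := (_ - _)%N; set e := points _.
  apply/ler_addgt0Pr => eps eps_gt0.
  (* One [delta] is lost to pruning and one to the density, so [2 * delta * t <= eps] is needed;
     [t.+1] keeps the denominator positive. *)
  pose delta := eps / (2 * t.+1%:R).
  have delta_gt0 : 0 < delta by rewrite divr_gt0 // mulr_gt0.
  (* The successor meets the requirement that the rank bound of pruning be positive. *)
  have [m prm] := prA delta (k j.+1).+1 delta_gt0 isT.
  have nd : \forall n \near U, Delta - delta < density R (A n).
    by apply: sU; apply: cvgr_gt dA _ _; rewrite ltrBlDr ltrDl.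
  have np : \forall n \near U, (m <= n)%N by apply: sU; apply: nbhs_infty_ge.
  (* The index [n] depends on [eps], but the points and the rank of its patch are those of [H_j],
     because the colours agree. *)
  have [n [gn [dn mn]]] := filter_ex (filterI (near_good j) (filterI nd np)).
  have [_ stn _] := gn; have [Bn _ _] := segmentE stn (jj j).
  have := pruned_layer (prm n mn) (step_linking stn (ltnSn j)).
  rewrite -Bn (good_points _ _ _ gn gN) (good_dim _ _ _ gn gN) -/t -/e => /(_ _) hn.
  have {}hn : (density R (A n) - delta) * t%:R <= e%:R.
    by apply: hn; apply: leqW; apply: le_dimP.
  have ht : delta * 2 * t%:R <= eps.
    have <- : delta * (2 * t.+1%:R) = eps by rewrite divfK ?lt0r_neq0 // mulr_gt0.
    by rewrite -mulrA !ler_pM2l // ler_nat.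
  have t_ge0 : 0 <= t%:R :> R by [].
  nra.
(* A single [n] is good for all patches up to [j]. Its segments are isomorphic to the chosen
   patches, and the body of their product is a submultiset of [A n]. *)
- have [n gn] := filter_ex (near_forall_ltn ultraU j.+1 near_good).
  have [n1 stn _] := gn j (ltnSn j).
  exists (cspace (A n)), (segment P n 0 j.+1); split.
    exists (fun i => segment P n i.-1 i); split.
      exact (segment_product stn (ltnSn j)).
    case=> [//|i] /= lei; apply: good_iso (goodN i); exact: gn.
  apply: Fmin (FA n n1); apply: submset_minor.
  have [-> _ _] := @segmentE _ _ _ _ _ _ _ stn 0 j.+1 (leqnn _).
  exact: layer_sub.
Qed.
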